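(* For each weakly topological structure $\mathcal M$, the category $\mathbf{ADS}(\mathcal M)$ of affine definable spaces over $\mathcal M$ and the category $\mathbf{DS}(\mathcal M)$ of definable spaces over $\mathcal M$ are finitely complete (they have all finite limits).
   Context: For a family of sets $\mathcal U$ and a set $V$, $V\underline{\cap}\,\mathcal U=\{V\cap U: U\in\mathcal U\}$. For a set $\Phi$ of families of sets, $\underline{\bigcup}\Phi=\{\bigcup\mathcal U:\mathcal U\in\Phi\}$. $\mathcal U\preceq\mathcal V$ means that $\bigcup\mathcal U=\bigcup\mathcal V$ and every member of $\mathcal U$ is contained in some member of $\mathcal V$. A generalized topological space (gts) is a triple $(X,Op_X,Cov_X)$, where $X$ is a set, $Op_X\subseteq\mathcal P(X)$ (the open sets) and $Cov_X\subseteq\mathcal P(Op_X)$ (the admissible families), such that: (finiteness) if $\mathcal U$ is a finite subfamily of $Op_X$, then $\bigcup\mathcal U,\bigcap\mathcal U\in Op_X$ (with $\bigcup\emptyset=\emptyset$, $\bigcap\emptyset=X$) and $\mathcal U\in Cov_X$; (stability) if $V\in Op_X$ and $\mathcal U\in Cov_X$, then $V\underline{\cap}\,\mathcal U\in Cov_X$; (transitivity) if $\Phi\subseteq Cov_X$ and $\underline{\bigcup}\Phi\in Cov_X$, then $\bigcup\Phi\in Cov_X$; (saturation) if $\mathcal U\in Cov_X$, $\mathcal V\subseteq Op_X$ and $\mathcal U\preceq\mathcal V$, then $\mathcal V\in Cov_X$; (regularity) if $W\subseteq X$, $\mathcal U\in Cov_X$ and $W\underline{\cap}\,\mathcal U\subseteq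 Op_X$, then $W\cap\bigcup\mathcal U\in Op_X$. A mapping between gtses is strictly continuous if the preimage $\{f^{-1}(U):U\in\mathcal U\}$ of every admissible family $\mathcal U$ is an admissible family. A family is essentially finite if some finite subfamily has the same union. A weakly topological structure is a (one-sorted, first order) structure $\mathcal M$ together with a topology on its underlying set $M$; each cartesian power $M^n$ carries the product topology. ''Definable'' means definable in $\mathcal M$ with parameters. A function sheaf over $\mathcal M$ on a gts $X$ is a sheaf $F$ of sets on $X$ (the sheaf property being required only for admissible coverings) such that $F(U)\subseteq M^U$ (functions $U\to M$) for each open $U$, with restriction of functions as restriction maps. A space over $\mathcal M$ is a pair $(X,O_X)$ with $X$ a gts and $O_X$ a function sheaf over $\mathcal M$ on $X$. A morphism $(X,O_X)\to(Y,O_Y)$ is a strictly continuous $f:X\to Y$ such that $h\circ f\in O_X(f^{-1}(V))$ for every open $V\subseteq Y$ and $h\in O_Y(V)$. These form the category $\mathbf{Space}(\mathcal M)$. An open subspace of $(X,O_X)$ is an open subset $U$ with the open sets and admissible families of $X$ contained in $U$ and with $O_X$ restricted to $U$. Each definable set $D\subseteq M^n$ is regarded as a space over $\mathcal M$: open sets are the relatively open definable subsets of $D$, admissible families are the essentially finite families of open sets, and $O_D(U)$ is the set of all definable continuous functions $U\to M$. An affine definable space over $\mathcal M$ is a space over $\mathcal M$ isomorphic to some such $D$. A definable space over $\mathcal M$ is a space over $\mathcal M$ having a finite open covering by affine definable (open) subspaces. $\mathbf{ADS}(\mathcal M)$ and $\mathbf{DS}(\mathcal M)$ are the corresponding full subcategories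 of $\mathbf{Space}(\mathcal M)$. *)

(* Defs.v *)
From HB Require Import structures.
From mathcomp Require Import all_boot boolp classical_sets functions cardinality.
From mathcomp Require Import topology.

Set Implicit Arguments.
Unset Strict Implicit.
Unset Printing Implicit Defensive.

Local Open Scope classical_set_scope.

Record category := Category {
  obj :> Type;
  hom : obj -> obj -> Type;
  idc : forall a, hom a a;
  comp : forall x y z, hom y z -> hom x y -> hom x z;
  comp_idl : forall a b (f : hom a b), comp (idc b) f = f;
  comp_idr : forall a b (f : hom a b), comp f (idc a) = f;
  comp_assoc : forall a b c d (h : hom c d) (g : hom b c) (f : hom a b),
    comp h (comp g f) = comp (comp h g) f }.

Record functor (J C : category) := Functor {
  fobj :> J -> C;
  fmap : forall a b : J, hom a b -> hom (fobj a) (fobj b);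
  fmap_id : forall a : J, fmap (idc a) = idc (fobj a);
  fmap_comp : forall (a b c : J) (g : hom b c) (f : hom a b),
    fmap (comp g f) = comp (fmap g) (fmap f) }.

Record cone (J C : category) (F : functor J C) := Cone {
  apex : C;
  leg : forall j : J, hom apex (F j);
  leg_natural : forall (i j : J) (f : hom i j),
    comp (fmap F f) (leg i) = leg j }.

Definition is_limit (J C : category) (F : functor J C) (L : cone F) : Prop :=
  forall K : cone F,
    exists! u : hom (apex K) (apex L), forall j, comp (leg L j) u = leg K j.

(* Finiteness is built in by using [finType]: asserting it of a [category]
   would make the universe of objects of spaces collide with that of sets. *)
Record finite_category := FiniteCategory {
  fin_obj : finType;
  fin_hom : fin_obj -> fin_obj -> finType;
  fin_idc : forall a, fin_hom a a;
  fin_comp : forall x y z, fin_hom y z -> fin_hom x y -> fin_hom x z;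
  fin_comp_idl : forall a b (f : fin_hom a b), fin_comp (fin_idc b) f = f;
  fin_comp_idr : forall a b (f : fin_hom a b), fin_comp f (fin_idc a) = f;
  fin_comp_assoc : forall a b c d
    (h : fin_hom c d) (g : fin_hom b c) (f : fin_hom a b),
    fin_comp h (fin_comp g f) = fin_comp (fin_comp h g) f }.

Coercion category_of_finite (J : finite_category) : category :=
  @Category (fin_obj J) (@fin_hom J) (@fin_idc J) (@fin_comp J)
    (@fin_comp_idl J) (@fin_comp_idr J) (@fin_comp_assoc J).

Definition finitely_complete (C : category) : Prop :=
  forall (J : finite_category) (F : functor J C), exists L : cone F, is_limit L.

Definition isomorphic (C : category) (a b : C) : Prop :=
  exists (f : hom a b) (g : hom b a), comp g f = idc a /\ comp f g = idc b.

Definition full_subcategory (C : category) (P : C -> Prop) : category :=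
  @Category {a : C | P a} (fun a b => hom (sval a) (sval b))
    (fun a => idc (sval a)) (fun a b c g f => comp g f)
    (fun a b f => comp_idl f) (fun a b f => comp_idr f)
    (fun a b c d h g f => comp_assoc h g f).

Definition refines (T : Type) (F G : set (set T)) : Prop :=
  \bigcup_(A in F) A = \bigcup_(B in G) B /\
  forall A, F A -> exists2 B, G B & A `<=` B.

Definition essentially_finite (T : Type) (F : set (set T)) : Prop :=
  exists G : set (set T),
    [/\ finite_set G, G `<=` F & \bigcup_(A in G) A = \bigcup_(A in F) A].

(* [\bigcap_(A in set0) A] is [setT], as required by (finiteness). *)
Record gts := Gts {
  gts_carrier :> Type;
  gopen : set (set gts_carrier);
  gcov : set (set (set gts_carrier));
  gcov_gopen : forall F, gcov F -> F `<=` gopen;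
  gts_finiteness : forall F, finite_set F -> F `<=` gopen ->
    [/\ gopen (\bigcup_(A in F) A), gopen (\bigcap_(A in F) A) & gcov F];
  gts_stability : forall V F, gopen V -> gcov F ->
    gcov [set V `&` A | A in F];
  gts_transitivity : forall Phi : set (set (set gts_carrier)),
    Phi `<=` gcov -> gcov [set \bigcup_(A in F) A | F in Phi] ->
    gcov (\bigcup_(F in Phi) F);
  gts_saturation : forall F G, gcov F -> G `<=` gopen -> refines F G -> gcov G;
  gts_regularity : forall W F, gcov F -> [set W `&` A | A in F] `<=` gopen ->
    gopen (W `&` \bigcup_(A in F) A) }.

Definition strictly_continuous (X Y : gts) (f : X -> Y) : Prop :=
  forall F, gcov F -> gcov [set f @^-1` A | A in F].

(* [sections U] is a set of functions on the subtype [U].  Its values at sets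
   [U] that are not open are irrelevant: no condition or later notion refers
   to them.  In [sheaf_gluing], [F] is viewed as the type of its members, so
   that [s] is a family of functions indexed by the members of [F]. *)
Record function_sheaf (M : Type) (X : gts) := FunctionSheaf {
  sections :> forall U : set X, set (U -> M);
  sheaf_restriction : forall U V : set X, gopen U -> gopen V ->
    forall (VU : V `<=` U) (s : U -> M),
    sections s -> sections (s \o subfun VU);
  sheaf_gluing : forall F : set (set X), gcov F ->
    forall s : (forall A : F, val A -> M),
    (forall A : F, sections (s A)) ->
    (forall A B : F, s A \o subfun (@subIsetl _ (val A) (val B)) =
                     s B \o subfun (@subIsetr _ (val A) (val B))) ->
    exists! t : (\bigcup_(A in F) A) -> M,
      sections t /\
      forall A : F, t \o subfun (bigcup_sup (set_valP A)) = s A }.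

Arguments sections {M X} _ U.

Record space (M : Type) := Space {
  space_gts :> gts;
  space_sheaf : function_sheaf M space_gts }.

Definition preimage_map (X Y : Type) (f : X -> Y) (V : set Y)
    (x : f @^-1` V) : V :=
  SigSub (mem_set (set_valP x : V (f (val x)))).

Record morphism (M : Type) (X Y : space M) := Morphism {
  mor_fun :> X -> Y;
  mor_strictly_continuous : strictly_continuous mor_fun;
  mor_sections : forall V : set Y, gopen V ->
    forall h : V -> M, space_sheaf Y V h ->
    space_sheaf X (mor_fun @^-1` V) (h \o @preimage_map _ _ mor_fun V) }.

Lemma morphism_eq (M : Type) (X Y : space M) (f g : morphism X Y) :
  mor_fun f = mor_fun g -> f = g.
Proof.
case: f g => [f f1 f2] [g g1 g2] /= fg; subst g.
by congr Morphism; apply: Prop_irrelevance.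
Qed.

Lemma id_strictly_continuous (X : gts) : strictly_continuous (@id X).
Proof. by move=> F; rewrite image_id. Qed.

Lemma comp_strictly_continuous (X Y Z : gts) (g : Y -> Z) (f : X -> Y) :
  strictly_continuous g -> strictly_continuous f ->
  strictly_continuous (g \o f).
Proof.
move=> sg sf F /sg /sf; rewrite image_comp.
by congr gcov.
Qed.

Lemma id_sections (M : Type) (X : space M) (V : set X) (h : V -> M) :
  space_sheaf X V h ->
  space_sheaf X (id @^-1` V) (h \o @preimage_map _ _ id V).
Proof.
suff -> : @preimage_map _ _ id V = id by [].
by apply/funext => x; apply: val_inj.
Qed.

Lemma comp_sections (M : Type) (X Y Z : space M) (g : morphism Y Z)
    (f : morphism X Y) (V : set Z) : gopen V ->
  forall h : V -> M, space_sheaf Z V h ->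
  space_sheaf X ((g \o f) @^-1` V) (h \o @preimage_map _ _ (g \o f) V).
Proof.
move=> oV h hV.
have ogV : gopen (g @^-1` V).
  have : gcov [set V] by
    case: (@gts_finiteness Z [set V]) => // A ->.
  move=> /(@mor_strictly_continuous _ _ _ g)/gcov_gopen; apply.
  by exists V.
have := mor_sections f ogV (mor_sections g oV hV).
congr (sections _ _ _); apply/funext => x /=; congr h.
by apply: val_inj.
Qed.

Definition id_morphism (M : Type) (X : space M) : morphism X X :=
  Morphism (@id_strictly_continuous X) (fun V _ h => @id_sections M X V h).

Definition comp_morphism (M : Type) (X Y Z : space M)
    (g : morphism Y Z) (f : morphism X Y) : morphism X Z :=
  Morphism
    (comp_strictly_continuous (@mor_strictly_continuous _ _ _ g)
                              (@mor_strictly_continuous _ _ _ f))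
    (@comp_sections M X Y Z g f).

Definition SpaceCat (M : Type) : category.
Proof.
refine (@Category (space M) (@morphism M) (@id_morphism M) (@comp_morphism M)
  _ _ _) => *; exact: morphism_eq.
Defined.

Section Gluing.
Variables (M : Type) (X : gts) (S : forall U : set X, set (U -> M)).

Lemma local_gluing (F : set (set X)) :
  (forall t : (\bigcup_(A in F) A) -> M,
     (forall A : F, S (t \o subfun (bigcup_sup (set_valP A)))) -> S t) ->
  forall s : (forall A : F, val A -> M), (forall A : F, S (s A)) ->
  (forall A B : F, s A \o subfun (@subIsetl _ (val A) (val B)) =
                   s B \o subfun (@subIsetr _ (val A) (val B))) ->
  exists! t : (\bigcup_(A in F) A) -> M,
    S t /\ forall A : F, t \o subfun (bigcup_sup (set_valP A)) = s A.
Proof.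
move=> Sloc s Ss scompat.
pose ix (x : \bigcup_(A in F) A) := cid2 (set_valP x).
have ixP x : s2val (ix x) (val x) := s2valP' (ix x).
pose t x : M := s (SigSub (mem_set (s2valP (ix x)))) (SigSub (mem_set (ixP x))).
have tE (A : F) : t \o subfun (bigcup_sup (set_valP A)) = s A.
  apply/funext => x /=; rewrite /t.
  set y := subfun _ x; set B : F := SigSub _.
  set x' : val B := SigSub _.
  have xx' : val x' = val x by [].
  have Bx : val B (val x) by rewrite -xx'; exact: set_valP.
  pose z : val A `&` val B := SigSub (mem_set (conj (set_valP x) Bx)).
  have := congr1 (fun k => k z) (scompat A B) => /= Ez.
  transitivity (s B (subfun (@subIsetr _ (val A) (val B)) z)).
    by congr (s B); apply: val_inj.
  by rewrite -Ez; congr (s A); apply: val_inj.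
exists t; split.
  by split=> //; apply: Sloc => A; rewrite tE.
move=> t' [_ t'E]; apply/funext => x.
have := congr1 (fun k => k (SigSub (mem_set (ixP x))))
               (t'E (SigSub (mem_set (s2valP (ix x))))).
by rewrite /t => <- /=; congr t'; apply: val_inj.
Qed.

End Gluing.

Lemma gluing_local (M : Type) (X : gts) (S : function_sheaf M X)
    (F : set (set X)) : gcov F ->
  forall t : (\bigcup_(A in F) A) -> M,
  (forall A : F, S _ (t \o subfun (bigcup_sup (set_valP A)))) -> S _ t.
Proof.
move=> cF t St.
have [|u [[Su uE] _]] := @sheaf_gluing M X S F cF
  (fun A => t \o subfun (bigcup_sup (set_valP A))) St.
  move=> A B; apply/funext => x /=; congr t.
  by apply: val_inj.
suff -> : t = u by [].
apply/funext => x; have [A FA Ax] := set_valP x.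
pose A' : F := SigSub (mem_set FA).
pose x' : val A' := SigSub (mem_set Ax).
have := congr1 (fun k => k x') (uE A') => /=; set y := subfun _ x'.
by have -> : y = x by apply: val_inj.
Qed.

Definition image_map (X Y : Type) (f : X -> Y) (A : set X) (x : A) : f @` A :=
  SigSub (mem_set (imageP f (set_valP x))).

Section OpenSubspace.
Variables (M : Type) (X : space M) (U : set X) (oU : gopen U).

Definition sub_gopen : set (set U) := [set A | gopen (val @` A)].

Definition sub_gcov : set (set (set U)) :=
  [set F | gcov [set val @` A | A in F]].

Let valU_bigcup (F : set (set U)) :
  val @` (\bigcup_(A in F) A) = \bigcup_(B in [set val @` A | A in F]) B.
Proof. by rewrite image_bigcup bigcup_image. Qed.

Let valU_I (A B : set U) : val @` (A `&` B) = val @` A `&` val @` B.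
Proof.
apply/seteqP; split=> [_ [x [Ax Bx] <-]|_ [[x Ax <-] [y By]]].
  by split; exists x.
by move/val_inj => yx; exists x => //; split=> //; rewrite -yx.
Qed.

Let sub_gcov_gopen F : sub_gcov F -> F `<=` sub_gopen.
Proof. by move=> cF A FA; apply: (gcov_gopen cF); exists A. Qed.

Let sub_finiteness F : finite_set F -> F `<=` sub_gopen ->
  [/\ sub_gopen (\bigcup_(A in F) A), sub_gopen (\bigcap_(A in F) A)
    & sub_gcov F].
Proof.
move=> fF oF.
have fF' : finite_set [set val @` A | A in F] by exact: finite_image.
have oF' : [set val @` A | A in F] `<=` @gopen X by move=> _ [A FA <-]; exact: oF.
have [o1 _ o3] := gts_finiteness fF' oF'.
split=> //; first by rewrite /sub_gopen /= valU_bigcup.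
have fG : finite_set (U |` [set val @` A | A in F]).
  by rewrite finite_setU; split=> //; exact: finite_set1.
have oG : U |` [set val @` A | A in F] `<=` @gopen X by move=> A [->//|/oF'].
have [_ + _] := gts_finiteness fG oG; rewrite /sub_gopen /=; congr gopen.
apply/seteqP; split=> [x Hx|_ [x Hx <-] _ [->|[A FA <-]]].
- have Ux : U x by apply: Hx; left.
  exists (SigSub (mem_set Ux)) => // A FA.
  have [|y Ay yx] := Hx (val @` A); first by right; exists A.
  suff -> : SigSub (mem_set Ux) = y by []; exact: val_inj.
- exact: set_valP.
- by exists x => //; exact: Hx.
Qed.

Let sub_stability V F : sub_gopen V -> sub_gcov F ->
  sub_gcov [set V `&` A | A in F].
Proof.
move=> oV /(gts_stability oV); rewrite /sub_gcov /=; congr gcov.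
apply/seteqP; split=> [_ [_ [A FA <-] <-]|_ [_ [A FA <-] <-]].
  by exists (V `&` A); [exists A | rewrite valU_I].
by exists (val @` A); [exists A | rewrite valU_I].
Qed.

Let sub_transitivity (Phi : set (set (set U))) :
    Phi `<=` sub_gcov -> sub_gcov [set \bigcup_(A in F) A | F in Phi] ->
  sub_gcov (\bigcup_(F in Phi) F).
Proof.
move=> cPhi cU; rewrite /sub_gcov /=.
have -> : [set val @` A | A in \bigcup_(F in Phi) F] =
    \bigcup_(G in [set [set val @` A | A in F] | F in Phi]) G :> set (set X).
  by rewrite image_bigcup bigcup_image.
apply: gts_transitivity; first by move=> _ [F PF <-]; exact: cPhi.
move: cU; rewrite /sub_gcov /=; congr gcov.
apply/seteqP; split=> [_ [_ [F PF <-] <-]|_ [_ [F PF <-] <-]].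
  by exists [set val @` A | A in F]; [exists F | rewrite valU_bigcup].
by exists (\bigcup_(A in F) A); [exists F | rewrite valU_bigcup].
Qed.

Let sub_saturation F G :
  sub_gcov F -> G `<=` sub_gopen -> refines F G -> sub_gcov G.
Proof.
move=> cF oG [FG rFG]; apply: (gts_saturation cF) => [_ [A GA <-]|].
  exact: oG.
split; first by rewrite -!valU_bigcup FG.
move=> _ [A FA <-]; have [B GB AB] := rFG _ FA.
by exists (val @` B); [exists B | exact: image_subset].
Qed.

Let sub_regularity W F :
    sub_gcov F -> [set W `&` A | A in F] `<=` sub_gopen ->
  sub_gopen (W `&` \bigcup_(A in F) A).
Proof.
move=> cF WF; rewrite /sub_gopen /= valU_I valU_bigcup.
apply: gts_regularity => // _ [_ [A FA <-] <-].
by rewrite -valU_I; apply: WF; exists A.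
Qed.

Definition open_sub_gts : gts :=
  Gts sub_gcov_gopen sub_finiteness sub_stability sub_transitivity
      sub_saturation sub_regularity.

(* A set [A] of points of [U] is identified with its image in [X]: sections
   over [A] are the sections of [X] over that image. *)
Definition sub_sections (A : set open_sub_gts) : set (A -> M) :=
  [set h | exists2 k : val @` A -> M,
             space_sheaf X (val @` A) k & h = k \o @image_map _ _ val A].

Let sub_restriction (A B : set open_sub_gts) : gopen A -> gopen B ->
  forall (BA : B `<=` A) (s : A -> M),
  sub_sections s -> sub_sections (s \o subfun BA).
Proof.
move=> oA oB BA s [k Sk ->].
exists (k \o subfun (image_subset val BA)); first exact: sheaf_restriction.
by apply/funext => x /=; congr k; apply: val_inj.
Qed.

Let unimage (A : set U) (y : val @` A) : A :=
  SigSub (mem_set (s2valP (cid2 (set_valP y)))).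

Let val_unimage (A : set U) (y : val @` A) : val (val (unimage y)) = val y.
Proof. exact: (s2valP' (cid2 (set_valP y))). Qed.

Let sub_sectionsP (A : set U) (h : A -> M) :
  sub_sections h <-> space_sheaf X (val @` A) (h \o @unimage A).
Proof.
split=> [[k Sk ->]|Sh].
  move: Sk; congr (sections _ _ _); apply/funext => y /=; congr k.
  by apply: val_inj; exact: esym (val_unimage y).
exists (h \o @unimage A) => //; apply/funext => y /=; congr h.
by apply: val_inj; apply: val_inj; rewrite val_unimage.
Qed.

Let sections_cast (A B : set X) (AB : B = A) (k : A -> M) :
  space_sheaf X A k -> space_sheaf X B (k \o subfun (subsetW AB)).
Proof.
subst B; congr (sections _ _ _); apply/funext => x /=; congr k; exact: val_inj.
Qed.

Let sub_gluing (F : set (set open_sub_gts)) : gcov F ->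
  forall s : (forall A : F, val A -> M),
  (forall A : F, sub_sections (s A)) ->
  (forall A B : F, s A \o subfun (@subIsetl _ (val A) (val B)) =
                   s B \o subfun (@subIsetr _ (val A) (val B))) ->
  exists! t : (\bigcup_(A in F) A) -> M,
    sub_sections t /\
    forall A : F, t \o subfun (bigcup_sup (set_valP A)) = s A.
Proof.
move=> cF; apply: local_gluing => t St; apply/sub_sectionsP.
pose k := (t \o @unimage _) \o subfun (subsetCW (valU_bigcup F)).
have Sk : space_sheaf X _ k.
  apply: gluing_local => // A'.
  have [A FA AA'] := set_valP A'.
  have /sub_sectionsP := St (SigSub (mem_set FA)) => /=.
  move/(sections_cast (esym AA')); congr (sections _ _).
  apply/funext => y; rewrite /k /=; congr t.
  by apply: val_inj; apply: val_inj; transitivity (val y);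
    [|symmetry]; exact: val_unimage.
move/(sections_cast (valU_bigcup F)): Sk; congr (sections _ _).
apply/funext => y; rewrite /k /=; congr t.
by apply: val_inj; apply: val_inj; transitivity (val y);
  [|symmetry]; exact: val_unimage.
Qed.

Definition open_subspace : space M :=
  Space (FunctionSheaf sub_restriction sub_gluing).

End OpenSubspace.

Record signature := Signature {
  fun_symbol : Type;
  fun_arity : fun_symbol -> nat;
  rel_symbol : Type;
  rel_arity : rel_symbol -> nat }.

(* The interpretations are arbitrary, and unrelated to the topology. *)
Record wt_structure := WTStructure {
  wt_sig : signature;
  wt_carrier :> topologicalType;
  fun_interp : forall f : fun_symbol wt_sig,
    ('I_(fun_arity f) -> wt_carrier) -> wt_carrier;
  rel_interp : forall r : rel_symbol wt_sig,
    set ('I_(rel_arity r) -> wt_carrier) }.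

(* The cartesian power [M^n], with the product topology. *)
Notation pow M n := {ptws 'I_n -> wt_carrier M}.

Definition snoc (T : Type) n (v : 'I_n -> T) (a : T) : 'I_n.+1 -> T :=
  fun i => if unlift ord_max i is Some j then v j else a.

Section Formulas.
Variable M : wt_structure.

(* Terms and formulas of the language of [M] expanded by a constant for each
   element of [M] (the parameters), with free variables among ['I_n]. *)
Inductive term (n : nat) : Type :=
| Var of 'I_n
| Par of M
| App (f : fun_symbol (wt_sig M)) of ('I_(fun_arity f) -> term n).

(* The quantifier binds the last variable, [ord_max]. *)
Inductive formula : nat -> Type :=
| Falsum n : formula n
| Equal n : term n -> term n -> formula n
| Rel n (r : rel_symbol (wt_sig M)) : ('I_(rel_arity r) -> term n) -> formula n
| Imply n : formula n -> formula n -> formula n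
| Forall n : formula n.+1 -> formula n.

Fixpoint eval n (v : 'I_n -> M) (t : term n) : M :=
  match t with
  | Var i => v i
  | Par a => a
  | App f ts => fun_interp (fun i => eval v (ts i))
  end.

Fixpoint sat n (phi : formula n) : ('I_n -> M) -> Prop :=
  match phi with
  | Falsum _ => fun _ => False
  | Equal _ t u => fun v => eval v t = eval v u
  | Rel _ r ts => fun v => rel_interp (r := r) (fun i => eval v (ts i))
  | Imply _ phi psi => fun v => sat phi v -> sat psi v
  | Forall _ phi => fun v => forall a, sat phi (snoc v a)
  end.

Definition definable n (D : set (pow M n)) : Prop :=
  exists phi : formula n, D = [set v | sat phi v].

Definition graph n (D : set (pow M n)) (A : set D) (h : A -> M) :
    set (pow M n.+1) :=
  [set snoc (val (val x)) (h x) | x in [set: A]].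

End Formulas.

Section DefinableSets.
Variable M : wt_structure.

Fixpoint rename_term n m (r : 'I_n -> 'I_m) (t : term M n) : term M m :=
  match t with
  | Var i => Var M (r i)
  | Par a => Par m a
  | App f ts => App (fun i => rename_term r (ts i))
  end.

Lemma eval_rename n m (r : 'I_n -> 'I_m) (v : 'I_m -> M) t :
  eval v (rename_term r t) = eval (v \o r) t.
Proof.
elim: t => //= f ts IH; congr fun_interp.
by apply/funext => i; exact: IH.
Qed.

Fixpoint rename n (phi : formula M n) :
    forall m, ('I_n -> 'I_m) -> formula M m :=
  match phi with
  | Falsum _ => fun m r => Falsum M m
  | Equal _ t u => fun m r => Equal (rename_term r t) (rename_term r u)
  | Rel _ _ ts => fun m r => Rel (fun i => rename_term r (ts i))
  | Imply _ phi psi => fun m r => Imply (rename phi r) (rename psi r)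
  | Forall _ phi => fun m r =>
      Forall (rename phi (snoc (lift ord_max \o r) ord_max))
  end.

Lemma snoc_lift T n (v : 'I_n -> T) a j : snoc v a (lift ord_max j) = v j.
Proof. by rewrite /snoc liftK. Qed.

Lemma snoc_max T n (v : 'I_n -> T) a : snoc v a ord_max = a.
Proof. by rewrite /snoc unlift_none. Qed.

Lemma sat_rename n (phi : formula M n) m (r : 'I_n -> 'I_m) v :
  sat (rename phi r) v <-> sat phi (v \o r).
Proof.
elim: phi m r v => {n} [n|n t u|n s ts|n phi IHphi psi IHpsi|n phi IH] m r v //=.
- by rewrite !eval_rename.
- suff -> : (fun i => eval v (rename_term r (ts i))) =
            (fun i => eval (v \o r) (ts i)) by [].
  by apply/funext => i; rewrite eval_rename.
- by split=> h /IHphi /h /IHpsi.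
- have E a : snoc v a \o snoc (lift ord_max \o r) ord_max = snoc (v \o r) a.
    apply/funext => i /=; case: (unliftP ord_max i) => [j ->|->].
      by rewrite !snoc_lift.
    by rewrite !snoc_max.
  by split=> h a; have := h a; rewrite IH E.
Qed.

Lemma definable_rename n m (r : 'I_n -> 'I_m) (D : set (pow M n)) :
  definable D -> definable [set v : pow M m | D (v \o r)].
Proof.
case=> phi ->; exists (rename phi r).
by apply/seteqP; split=> v /= /sat_rename.
Qed.

Lemma definable0 n : definable (set0 : set (pow M n)).
Proof. by exists (Falsum M n). Qed.

Lemma definableC n (D : set (pow M n)) : definable D -> definable (~` D).
Proof. by case=> phi ->; exists (Imply phi (Falsum M n)). Qed.

Lemma definableU n (D E : set (pow M n)) :
  definable D -> definable E -> definable (D `|` E).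
Proof.
move=> [phi ->] [psi ->].
exists (Imply (Imply phi (Falsum M n)) psi).
apply/seteqP; split=> v /=; first by case.
by have [|nphi h] := pselect (sat phi v); [left | right; exact: h].
Qed.

Lemma definableI n (D E : set (pow M n)) :
  definable D -> definable E -> definable (D `&` E).
Proof.
move=> dD dE; rewrite -[D `&` E]setCK setCI.
by apply/definableC/definableU; exact: definableC.
Qed.

Lemma finite_set_elim (I : Type) (Q : set I -> Prop) :
  Q set0 -> (forall i P, Q P -> Q (i |` P)) ->
  forall P, finite_set P -> Q P.
Proof.
move=> Q0 QU P /(@finite_seqP {classic I})[s ->].
elim: s => [|i s IH]; first by rewrite set_nil.
have -> : [set` i :: s] = i |` [set` s].
  by apply/seteqP; split=> j /=; rewrite inE => /predU1P.
exact: QU.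
Qed.

Lemma definable_bigcup n (I : Type) (P : set I) (D : I -> set (pow M n)) :
  finite_set P -> (forall i, P i -> definable (D i)) ->
  definable (\bigcup_(i in P) D i).
Proof.
move=> fP; pattern P; apply: finite_set_elim fP => {P} [_|i P IH dD].
  by rewrite bigcup_set0; exact: definable0.
rewrite bigcup_setU1; apply: definableU; first by apply: dD; left.
by apply: IH => j Pj; apply: dD; right.
Qed.

Section DefinableSpace.
Variables (n : nat) (D : set (pow M n)) (dD : definable D).

(* [open A] is openness in the topology induced on the subtype [D]. *)
Definition def_gopen : set (set D) :=
  [set A : set D | definable (val @` A) /\ open A].

Definition def_gcov : set (set (set D)) :=
  [set F | F `<=` def_gopen /\ essentially_finite F].

Let valD_I (A B : set D) : val @` (A `&` B) = val @` A `&` val @` B.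
Proof.
apply/seteqP; split=> [_ [x [Ax Bx] <-]|_ [[x Ax <-] [y By]]].
  by split; exists x.
by move/val_inj => yx; exists x => //; split=> //; rewrite -yx.
Qed.

Let def_gopenI (A B : set D) : def_gopen A -> def_gopen B -> def_gopen (A `&` B).
Proof.
move=> [dA oA] [dB oB]; split; last exact: openI.
by rewrite valD_I; exact: definableI.
Qed.

Let def_gopenT : def_gopen setT.
Proof.
split; last exact: openT.
suff -> : val @` [set: D] = D by [].
apply/seteqP; split=> [_ [x _ <-]|x Dx]; first exact: set_valP.
by exists (SigSub (mem_set Dx)).
Qed.

Let def_gopen_bigcup (F : set (set D)) : finite_set F -> F `<=` def_gopen ->
  def_gopen (\bigcup_(A in F) A).
Proof.
move=> fF oF; split; last by apply: bigcup_open => A /oF[].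
by rewrite image_bigcup; apply: definable_bigcup => // A /oF[].
Qed.

Let def_gcov_gopen F : def_gcov F -> F `<=` def_gopen.
Proof. by case. Qed.

Let def_finiteness F : finite_set F -> F `<=` def_gopen ->
  [/\ def_gopen (\bigcup_(A in F) A), def_gopen (\bigcap_(A in F) A)
    & def_gcov F].
Proof.
move=> fF oF; split; [exact: def_gopen_bigcup | | by split=> //; exists F; split].
move: oF; pattern F; apply: finite_set_elim fF => {F} [_|A F IH oF].
  by rewrite bigcap_set0.
rewrite bigcap_setU1; apply: def_gopenI; first by apply: oF; left.
by apply: IH => B FB; apply: oF; right.
Qed.

Let def_stability V F : def_gopen V -> def_gcov F ->
  def_gcov [set V `&` A | A in F].
Proof.
move=> oV [oF [G [fG GF UG]]]; split.
  by move=> _ [A FA <-]; apply: def_gopenI => //; exact: oF.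
exists [set V `&` A | A in G]; split; first exact: finite_image.
  exact: image_subset.
by rewrite !bigcup_image -!setI_bigcupr UG.
Qed.

Let def_transitivity (Phi : set (set (set D))) :
    Phi `<=` def_gcov -> def_gcov [set \bigcup_(A in F) A | F in Phi] ->
  def_gcov (\bigcup_(F in Phi) F).
Proof.
move=> cPhi [_ [G [fG GPhi UG]]]; split.
  by move=> A [F PF FA]; have [+ _] := cPhi F PF; exact.
have H B : exists H : set (set D), G B ->
    [/\ finite_set H, H `<=` \bigcup_(F in Phi) F & \bigcup_(A in H) A = B].
  have [/GPhi[F PF <-]|nGB] := pselect (G B); last by exists set0.
  have [_ [H [fH HF UH]]] := cPhi _ PF; exists H => _; split=> // A /HF FA.
  by exists F.
have [h hP] := choice H.
exists (\bigcup_(B in G) h B); split.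
- by apply: bigcup_finite => // B /hP[].
- by move=> A [B /hP[_ + _] hBA]; exact.
- transitivity (\bigcup_(B in G) B).
    apply/seteqP; split=> [x [A [B GB hBA] Ax]|x [B GB]].
      by exists B => //; have [_ _ <-] := hP B GB; exists A.
    by have [_ _ <-] := hP B GB => -[A hBA Ax]; exists A => //; exists B.
  rewrite UG bigcup_image.
  apply/seteqP; split=> [x [F PF [A FA Ax]]|x [A [F PF FA] Ax]].
    by exists A => //; exists F.
  by exists F => //; exists A.
Qed.

Let def_saturation F G :
  def_gcov F -> G `<=` def_gopen -> refines F G -> def_gcov G.
Proof.
move=> [_ [H [fH HF UH]]] oG [FG rFG]; split=> //.
have E A : exists B, H A -> G B /\ A `<=` B.
  have [/HF/rFG[B GB AB]|nHA] := pselect (H A); first by exists B.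
  by exists set0.
have [b bP] := choice E.
exists (b @` H); split; first exact: finite_image.
  by move=> _ [A /bP[+ _] <-].
rewrite -FG bigcup_image; apply/seteqP; split=> x.
  by move=> [A /bP[GbA _] bAx]; rewrite FG; exists (b A).
by rewrite -UH => -[A HA Ax]; exists A => //; have [_] := bP A HA; exact.
Qed.

Let def_regularity W F :
    def_gcov F -> [set W `&` A | A in F] `<=` def_gopen ->
  def_gopen (W `&` \bigcup_(A in F) A).
Proof.
move=> [_ [G [fG GF <-]]] WF.
have -> : W `&` \bigcup_(A in G) A = \bigcup_(A in [set W `&` A | A in G]) A.
  by rewrite bigcup_image setI_bigcupr.
apply: def_gopen_bigcup; first exact: finite_image.
by apply: subset_trans WF; exact: image_subset.
Qed.

Definition definable_gts : gts :=
  Gts def_gcov_gopen def_finiteness def_stability def_transitivity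
      def_saturation def_regularity.

(* [graph h] lists the argument first and the value as last coordinate. *)
Definition definable_sections (A : set definable_gts) : set (A -> M) :=
  [set h | definable (graph h) /\ continuous (h : (A : set D) -> M)].

Lemma continuous_subfun (T : topologicalType) (A B : set T) (AB : A `<=` B) :
  continuous (subfun AB).
Proof.
apply/continuousP => _ [V oV <-]; exists V => //.
Qed.

Let def_restriction (A B : set definable_gts) : gopen A -> gopen B ->
  forall (BA : B `<=` A) (s : A -> M),
  definable_sections s -> definable_sections (s \o subfun BA).
Proof.
move=> oA [dB _] BA s [ds cs]; split; last first.
  move=> x; apply: continuous_comp; last exact: cs.
  exact: continuous_subfun.
have dC := definable_rename (fun j : 'I_n => lift ord_max j) dB.
suff -> : graph (s \o subfun BA) =
    graph s `&` [set v : pow M n.+1 | (val @` B) (v \o (fun j : 'I_n => lift ord_max j))].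
  exact: definableI.
have E v a : snoc v a \o (fun j : 'I_n => lift ord_max j) = v :> ('I_n -> M).
  by apply/funext => j /=; rewrite snoc_lift.
apply/seteqP; split=> [_ [x _ <-]|_ [[x _ <-]]] /=.
  split; first by exists (subfun BA x).
  by rewrite E; exists (val x) => //; exact: set_valP.
rewrite E => -[y By /val_inj yx].
have Bx : B (val x) by move: By; rewrite yx.
exists (SigSub (mem_set Bx)) => //=; congr snoc; congr s; exact: val_inj.
Qed.

Let def_gluing (F : set (set definable_gts)) : gcov F ->
  forall s : (forall A : F, val A -> M),
  (forall A : F, definable_sections (s A)) ->
  (forall A B : F, s A \o subfun (@subIsetl _ (val A) (val B)) =
                   s B \o subfun (@subIsetr _ (val A) (val B))) ->
  exists! t : (\bigcup_(A in F) A) -> M,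
    definable_sections t /\
    forall A : F, t \o subfun (bigcup_sup (set_valP A)) = s A.
Proof.
move=> cF; apply: local_gluing => t St.
have [oF [G [fG GF UG]]] := cF; split.
  have -> : graph t = \bigcup_(A in G)
      [set v | exists FA : F A, graph (t \o subfun (bigcup_sup FA)) v].
    apply/seteqP; split=> [_ [x _ <-]|_ [A GA [FA [x _ <-]]]]; last first.
      by exists (subfun (bigcup_sup FA) x).
    have : (\bigcup_(A in G) A) (val x) by rewrite UG; exact: set_valP.
    move=> [A GA Ax]; exists A => //; exists (GF _ GA).
    exists (SigSub (mem_set Ax)) => //=; congr snoc; congr t; exact: val_inj.
  apply: definable_bigcup => // A GA.
  have [dA _] := St (SigSub (mem_set (GF _ GA))).
  move: dA; congr definable; apply/seteqP; split=> v.
    by move=> [x _ <-]; exists (GF _ GA), x => //=; congr snoc; congr t; exact: val_inj.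
  by move=> [FA [x _ <-]]; exists x => //=; congr snoc; congr t; exact: val_inj.
apply/continuousP => V oV.
have H (A : F) : exists2 W : set D, open W &
    forall x : \bigcup_(A in F) A, val A (val x) -> W (val x) <-> V (t x).
  have [_ /continuousP/(_ V oV)[W oW WE]] := St A.
  exists W => // x Ax.
  have := congr1 (fun S => S (SigSub (mem_set Ax))) WE => /= ->.
  set z := subfun _ _; suff -> : z = x by [].
  exact: val_inj.
have {}H A : exists W : set D, F A -> open W /\
    forall x : \bigcup_(A in F) A, A (val x) -> W (val x) <-> V (t x).
  have [FA|nFA] := pselect (F A); last by exists set0.
  by have [W oW WP] := H (SigSub (mem_set FA)); exists W.
have [w wP] := choice H.
exists (\bigcup_(A in F) (w A `&` A)).
  apply: bigcup_open => A FA; apply: openI; first by case: (wP A FA).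
  by have [] := oF A FA.
apply/seteqP; split=> x /=.
  by move=> [A /wP[_ wA] [wx Ax]]; apply/wA.
move=> Vx; have [A FA Ax] := set_valP x; exists A => //; split=> //.
by have [_ /(_ x Ax) wA] := wP A FA; apply/wA.
Qed.

Definition definable_set_space : space M :=
  Space (FunctionSheaf def_restriction def_gluing).

End DefinableSpace.
End DefinableSets.

Definition affine_definable (M : wt_structure) (X : SpaceCat M) : Prop :=
  exists (n : nat) (D : set (pow M n)) (dD : definable D),
    isomorphic X (definable_set_space dD : SpaceCat M).

Definition definable_space (M : wt_structure) (X : SpaceCat M) : Prop :=
  exists C : set (set (X : space M)),
    [/\ finite_set C, C `<=` @gopen (X : space M), \bigcup_(U in C) U = setT &
        forall (U : set (X : space M)) (oU : gopen U), C U ->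
          affine_definable (open_subspace oU)].

Definition ADS (M : wt_structure) : category :=
  full_subcategory (@affine_definable M).

Definition DS (M : wt_structure) : category :=
  full_subcategory (@definable_space M).

(* Main.v *)
From mathcomp Require Import all_boot boolp classical_sets functions cardinality.
From mathcomp Require Import topology.
Require Import Defs.

Set Implicit Arguments.
Unset Strict Implicit.
Unset Printing Implicit Defensive.

Local Open Scope classical_set_scope.

(** A limit of definable spaces has to be built, and then to be shown
    definable again. Both tasks become easy once definable spaces are
    described by their plots, the morphisms from definable sets into them.
    Charts are plots, and openness and being a section can be tested in
    charts, so a definable space is determined by its plots.

    Given a finite diagram of spaces [X j], take the set-theoretic limit [L],
    call a map from a definable set to [L] a plot when all its components are
    morphisms, and give [L] the structure that the plots determine: a set is
    open when its preimages along all plots are, a function is a section when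
    its composites with all plots are, and the admissible families are the
    essentially finite families of open sets ([plot_space], [limit_space]). No
    choice of atlas enters, so there is no compatibility between charts to
    check. A cone from a definable space [K] induces a map from [K] to [L]
    that sends charts of [K] to plots of [L], hence a morphism; this is the
    universal property ([limit_mediating]). The projections of [L] are
    morphisms because the admissible families of a definable space are
    essentially finite ([definable_space_finitary]).

    It remains to cover [L] by finitely many charts. Choose for every [j] a
    chart [q j], an open embedding of a definable set [D j]. The points of [L]
    all of whose components lie in the chosen charts form an open set. In
    coordinates it is the set of tuples [(a j)], with [a j] in [D j], such
    that [q j (a j)] is the image of [q i (a i)] for every arrow from [i] to
    [j]. This set is definable, because the map between charts induced by an
    arrow is given by sections on an open domain ([definable_limit_set]), and
    it is a chart of [L] ([limit_chart]), because a map into a definable set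
    with coordinates that are sections pulls open sets back to open sets and
    sections back to sections ([gopen_pull], [psec_dpull]). There are finitely
    many tuples of charts, which settles definable spaces; if every [X j] is
    affine, then one chart is enough for each [j] and also for [L], which
    settles affine definable spaces. *)

(** * Definable sets *)

Section Definability.
Variable M : wt_structure.

Lemma definable_bigcap n (I : finType) (P : set I) (D : I -> set (pow M n)) :
  (forall i, P i -> definable (D i)) -> definable (\bigcap_(i in P) D i).
Proof.
move=> dD; rewrite -[X in definable X]setCK setC_bigcap; apply: definableC.
by apply: definable_bigcup => [|i Pi]; [exact: finite_finset | exact/definableC/dD].
Qed.

Lemma definable_ex n (D : set (pow M n.+1)) :
  definable D -> definable [set v : pow M n | exists a, D (snoc v a)].
Proof.
move=> /definableC[phi phiE]; rewrite -[X in definable X]setCK.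
apply: definableC; exists (Forall phi); apply/seteqP; split=> v /=.
  move=> nD a; suff : (~` D) (snoc v a) by rewrite phiE.
  by move=> Dva; apply: nD; exists a.
move=> h [a Dva]; have : (~` D) (snoc v a) by rewrite phiE; exact: h.
exact.
Qed.

Definition join_pt (T : Type) n m (v : 'I_n -> T) (w : 'I_m -> T) :
    'I_(n + m) -> T :=
  fun i => match fintype.split i with inl j => v j | inr k => w k end.

Lemma join_ptl T n m (v : 'I_n -> T) (w : 'I_m -> T) j :
  join_pt v w (lshift m j) = v j.
Proof. by rewrite /join_pt (unsplitK (inl j)). Qed.

Lemma join_ptr T n m (v : 'I_n -> T) (w : 'I_m -> T) k :
  join_pt v w (rshift n k) = w k.
Proof. by rewrite /join_pt (unsplitK (inr k)). Qed.

Lemma definable_ex_block n m (D : set (pow M (n + m))) :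
  definable D -> definable [set v : pow M n | exists w : 'I_m -> M, D (join_pt v w)].
Proof.
elim: m D => [|m IH] D dD.
  have := definable_rename (cast_ord (addn0 n)) dD; congr definable.
  have E (v : 'I_n -> M) w : join_pt v w = v \o cast_ord (addn0 n).
    apply/funext => i /=; rewrite -(splitK i).
    case: (fintype.split i) => [j|[]//]; rewrite /= join_ptl; congr v; exact: val_inj.
  apply/seteqP; split=> v /=; last by case=> w; rewrite E.
  have w0 (i : 'I_0) : M by case: i.
  by move=> Dv; exists w0; rewrite E.
have := IH _ (definable_ex (definable_rename (cast_ord (addnS n m)) dD)).
congr definable.
have E (v : 'I_n -> M) (w : 'I_m -> M) a :
   snoc (join_pt v w) a \o cast_ord (addnS n m) = join_pt v (snoc w a).
  apply/funext => i /=; rewrite -(splitK i); case: (fintype.split i) => /= [j|k].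
    rewrite join_ptl.
    have -> : cast_ord (addnS n m) (lshift m.+1 j) = lift ord_max (lshift m j).
      by apply: val_inj; rewrite /= /bump leqNgt ltn_addr.
    by rewrite snoc_lift join_ptl.
  rewrite join_ptr; case: (unliftP ord_max k) => [l ->|->].
    have -> : cast_ord (addnS n m) (rshift n (lift ord_max l)) =
        lift ord_max (rshift n l).
      by apply: val_inj; rewrite /= /bump leqNgt ltn_ord leqNgt ltn_add2l ltn_ord.
    by rewrite !snoc_lift join_ptr.
  have -> : cast_ord (addnS n m) (rshift n ord_max) = ord_max by exact: val_inj.
  by rewrite !snoc_max.
apply/seteqP; split=> v /=.
  by move=> [w [a]]; rewrite E => Dv; exists (snoc w a).
move=> [w Dvw]; exists (w \o lift ord_max), (w ord_max); rewrite E.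
congr (D (join_pt v _)): Dvw; apply/funext => k.
case: (unliftP ord_max k) => [l ->|->]; by rewrite ?snoc_lift ?snoc_max.
Qed.

End Definability.

(** * Sections as partial functions *)

(** Curried form of a section: the point and the proof that it lies in [U] are
    separate arguments.  Restriction and pullback then amount to changing the
    proof, and proof irrelevance replaces casts between subtypes. *)
Definition psec (M : Type) (X : space M) (U : set X) (g : forall x, U x -> M) :=
  space_sheaf X U (fun x : U => g (val x) (set_valP x)).
Arguments psec {M} X U g.

Section PartialSections.
Variables (M : Type) (X : space M).
Implicit Types U V : set X.

Lemma psec_ext U V (g : forall x, U x -> M) (h : forall x, V x -> M) :
  U = V -> (forall x Ux Vx, g x Ux = h x Vx) -> psec X U g -> psec X V h.
Proof.
move=> UV; subst V => gh; rewrite /psec; congr (sections _ _ _).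
by apply/funext => x; exact: gh.
Qed.

Lemma psecE U (h : U -> M) :
  space_sheaf X U h <-> psec X U (fun x Ux => h (SigSub (mem_set Ux))).
Proof.
rewrite /psec; suff -> : (fun x : U => h (SigSub (mem_set (set_valP x)))) = h by [].
by apply/funext => x; congr h; exact: val_inj.
Qed.

Lemma psec_restrict U V (VU : V `<=` U) (g : forall x, U x -> M) :
  gopen U -> gopen V -> psec X U g -> psec X V (fun x Vx => g x (VU x Vx)).
Proof.
move=> oU oV /(sheaf_restriction oU oV VU); congr (sections _ _ _).
by apply/funext => x /=; congr g; exact: Prop_irrelevance.
Qed.

(** Uniqueness in the gluing axiom turns it into locality: a function that is a
    section on every member of an admissible family is the gluing of these
    sections. *)
Lemma psec_glue (F : set (set X)) (g : forall x, (\bigcup_(A in F) A) x -> M) :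
  gcov F ->
  (forall A (FA : F A), psec X A (fun x Ax => g x (bigcup_sup FA Ax))) ->
  psec X (\bigcup_(A in F) A) g.
Proof.
move=> cF Fg; apply: gluing_local => // A.
have := Fg _ (set_valP A); congr (sections _ _ _).
by apply/funext => x /=; congr g; exact: Prop_irrelevance.
Qed.

End PartialSections.

Lemma psec_pull (M : Type) (X Y : space M) (f : morphism X Y) (V : set Y)
    (g : forall y, V y -> M) :
  gopen V -> psec Y V g -> psec X (f @^-1` V) (fun x Vfx => g (f x) Vfx).
Proof.
move=> oV /(mor_sections f oV); congr (sections _ _ _).
by apply/funext => x /=; congr g; exact: Prop_irrelevance.
Qed.

Lemma snoc_inj T n (u v : 'I_n -> T) a b : snoc u a = snoc v b -> u = v /\ a = b.
Proof.
move=> uv; split; last by have := congr1 (@^~ ord_max) uv; rewrite !snoc_max.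
apply/funext => j.
by have := congr1 (@^~ (lift ord_max j)) uv; rewrite !snoc_lift.
Qed.

(** * Maps into a definable set given by sections *)

Section DefinableSetMaps.
Variables (M : wt_structure) (n : nat) (D : set (pow M n)) (dD : definable D).
Local Notation X := (definable_set_space dD).

Lemma psec_graph (A : set D) (g : forall x : D, A x -> M) : psec X A g ->
  exists2 G : set (pow M n.+1), definable G &
    forall u a, G (snoc u a) <-> exists (x : D) (Ax : A x), val x = u /\ g x Ax = a.
Proof.
move=> [dG _]; eexists; first exact: dG.
move=> u a; split=> [[x _ E]|[x [Ax [<- <-]]]].
  by have [<- <-] := snoc_inj E; exists (val x), (set_valP x).
exists (SigSub (mem_set Ax)) => //=; congr snoc.
exact: (congr1 (g x) (Prop_irrelevance _ _)).
Qed.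

Variables (m : nat) (A : set D) (f : forall x : D, A x -> 'I_m -> M).
Hypotheses (oA : gopen (A : set X))
           (fs : forall k, psec X A (fun x Ax => f Ax k)).

(** Common source of the two definability statements needed for pullbacks: the
    coordinates [f] of a point are replaced by an existentially quantified block
    of variables constrained by the graphs of the coordinate sections.  The
    point itself sits among the [N] variables at the positions [r]; taking
    [N = n] gives preimages of sets, and [N = n + 1] gives graphs of composite
    functions. *)
Lemma definable_pull N (r : 'I_n -> 'I_N) (S : set (pow M (N + m))) :
  definable S ->
  definable [set v : pow M N | exists (x : D) (Ax : A x),
               val x = v \o r /\ S (join_pt v (f Ax))].
Proof.
move=> dS; have [dA _] := oA.
have /choice[G GP] : forall k, exists G : set (pow M n.+1), definable G /\
    forall u a, G (snoc u a) <-> exists (x : D) (Ax : A x), val x = u /\ f Ax k = a.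
  by move=> k; have [G dG GP] := psec_graph (fs k); exists G.
pose T : set (pow M (N + m)) := S `&`
  [set v : pow M (N + m) | (val @` A) (v \o (@lshift N m \o r))] `&`
  \bigcap_(k in [set: 'I_m])
    [set v : pow M (N + m) | G k (v \o snoc (@lshift N m \o r) (rshift N k))].
have dT : definable T.
  apply: definableI; first by apply: definableI => //; exact: definable_rename.
  by apply: definable_bigcap => k _; apply: definable_rename; case: (GP k).
have := definable_ex_block dT; congr definable.
have E1 (v : 'I_N -> M) w : join_pt v w \o (@lshift N m \o r) = v \o r.
  by apply/funext => i /=; rewrite join_ptl.
have E2 (v : 'I_N -> M) w k :
    join_pt v w \o snoc (@lshift N m \o r) (rshift N k) = snoc (v \o r) (w k).
  apply/funext => i /=; case: (unliftP ord_max i) => [j ->|->].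
    by rewrite !snoc_lift join_ptl.
  by rewrite !snoc_max join_ptr.
apply/seteqP; split=> v /=.
  move=> [w [[Svw /=]]]; rewrite E1 => -[x Ax xv] H; exists x, Ax; split=> //.
  suff -> : f Ax = w by [].
  apply/funext => k; have := H k I; rewrite /= E2 => /(GP k).2[y [Ay [yv <-]]].
  have yx : y = x by apply: val_inj; exact: etrans yv (esym xv).
  by subst y; congr f; exact: Prop_irrelevance.
move=> [x [Ax [xv Sx]]]; exists (f Ax); split=> [|k _] /=.
  by split=> //=; rewrite E1; exists x.
by rewrite E2; apply/(GP k).2; exists x, Ax.
Qed.

(** The topology of [M^m] is initial for the coordinates, so [f] is continuous on
    the open set [A], and its preimages are open in [D] too. *)
Lemma open_pull (W : set (pow M m)) : open W ->
  open [set x : D | exists Ax : A x, W (f Ax)].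
Proof.
move=> oW; pose F (x : A) : pow M m := f (set_valP x).
have /continuousP/(_ W oW)[Z oZ ZE] : continuous F.
  move=> x; have FF : Filter (F @ x) by exact/fmap_filter/nbhs_filter.
  apply/cvg_sup => k.
  apply: (@continuous_comp_initial (pow M m) A M (fun h => h k) F) => y.
  by have [_] := fs k; exact.
have [_ oA'] := oA.
suff -> : [set x : D | exists Ax : A x, W (f Ax)] = Z `&` A by exact: openI.
have ZP (x : A) : Z (val x) <-> W (F x).
  by rewrite -[W _]/((F @^-1` W) x) -ZE.
apply/seteqP; split=> x /=.
  move=> [Ax Wx]; split=> //; apply/(ZP (SigSub (mem_set Ax))).
  rewrite /F; suff -> : set_valP (SigSub (mem_set Ax)) = Ax by [].
  exact: Prop_irrelevance.
move=> [Zx Ax]; pose x' : A := SigSub (mem_set Ax).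
by have /ZP := (Zx : Z (val x')); exists (set_valP x').
Qed.

End DefinableSetMaps.

Section DefinableMorphisms.
Variables (M : wt_structure) (n : nat) (D : set (pow M n)) (dD : definable D).
Variables (m : nat) (E : set (pow M m)) (dE : definable E).
Local Notation X := (definable_set_space dD).
Local Notation Y := (definable_set_space dE).
Variables (A : set D) (f : forall x : D, A x -> E).
Hypotheses (oA : gopen (A : set X))
           (fs : forall k, psec X A (fun x Ax => val (f Ax) k)).

Lemma gopen_pull (B : set Y) : gopen B ->
  gopen ([set x : D | exists Ax : A x, B (f Ax)] : set X).
Proof.
move=> [dB [W oW WB]]; split.
  have := definable_pull oA fs id (definable_rename (@rshift n m) dB).
  have e (v : 'I_n -> M) (w : 'I_m -> M) : join_pt v w \o @rshift n m = w.
    by apply/funext => k /=; rewrite join_ptr.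
  congr definable; apply/seteqP; split=> v /=.
    move=> [x [Ax [xv]]]; rewrite e => -[y By /val_inj yf].
    by exists x; [exists Ax; rewrite -yf | exact: xv].
  move=> [x [Ax Bx] <-]; exists x, Ax; split=> //.
  by rewrite e; exists (f Ax).
have := open_pull oA fs oW; congr open.
by rewrite -WB.
Qed.

(** The composite is a separate function [h], specified only through its values,
    so that the caller chooses how it depends on the proof that a point lies in
    the preimage. *)
Lemma psec_dpull (B : set Y) (g : forall y, B y -> M)
    (h : forall x : D, (exists Ax : A x, B (f Ax)) -> M) :
  gopen B -> psec Y B g ->
  (forall x H (Ax : A x) (Bx : B (f Ax)), h x H = g _ Bx) ->
  psec X [set x : D | exists Ax : A x, B (f Ax)] h.
Proof.
move=> oB sg hE; have [G dG GP] := psec_graph sg; split.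
  pose r := snoc (@rshift n.+1 m) (lshift m (@ord_max n)).
  have := definable_pull oA fs (lift ord_max) (definable_rename r dG).
  have e (v : 'I_n.+1 -> M) (w : 'I_m -> M) : join_pt v w \o r = snoc w (v ord_max).
    apply/funext => i /=; case: (unliftP ord_max i) => [j ->|->].
      by rewrite /r !snoc_lift join_ptr.
    by rewrite /r !snoc_max join_ptl.
  have e' (v : 'I_n.+1 -> M) : snoc (v \o lift ord_max) (v ord_max) = v.
    by apply/funext => i; case: (unliftP ord_max i) => [j ->|->];
      rewrite ?snoc_lift ?snoc_max.
  congr definable; apply/seteqP; split=> v /=.
    move=> [x [Ax [xv]]]; rewrite e => /GP[y [By [/val_inj yf gy]]].
    have Bx : B (f Ax) by rewrite -yf.
    have ABx : [set x : D | exists Ax : A x, B (f Ax)] x by exists Ax.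
    exists (SigSub (mem_set ABx)) => //=.
    rewrite -[RHS]e'; congr snoc => //.
    rewrite -gy (hE _ _ _ Bx); move: Bx; rewrite -yf => Bx.
    exact: (congr1 (g y) (Prop_irrelevance _ _)).
  move=> [x _ <-]; have [Ax Bx] := set_valP x.
  exists (val x), Ax; split; first by apply/funext => j /=; rewrite snoc_lift.
  rewrite e; apply/GP; exists (f Ax), Bx; split=> //.
  by rewrite snoc_max (hE _ _ _ Bx).
apply/continuousP => V oV.
have [_ /continuousP/(_ V oV)[W [W0 oW0 W0E] WE]] := sg.
exists [set x : D | exists Ax : A x, W0 (val (f Ax))]; first exact: (open_pull oA fs).
have WP y (By : B y) : W0 (val y) <-> V (g y By).
  pose y' : B := SigSub (mem_set By).
  rewrite -[g y By](congr1 (g y) (Prop_irrelevance (set_valP y') By)).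
  by have := congr1 (fun S => S y') WE; rewrite -W0E /= => ->.
apply/seteqP; split=> x /=; have [Ax Bx] := set_valP x; rewrite (hE _ _ _ Bx).
  by move=> [Ax']; rewrite (Prop_irrelevance Ax' Ax) => /(WP _ Bx).
by move=> /(WP _ Bx); exists Ax.
Qed.

End DefinableMorphisms.

(** * Generalized topologies with essentially finite coverings *)

Section GtsFacts.
Variable X : gts.
Implicit Types (U V : set X) (F : set (set X)).

Lemma gcov_essentially_finite F : F `<=` @gopen X -> essentially_finite F -> gcov F.
Proof.
move=> oF [G [fG GF UG]].
have [_ _ cG] := gts_finiteness fG (subset_trans GF oF).
by apply: (gts_saturation cG oF); split=> // A /GF FA; exists A.
Qed.

Lemma gopen_bigcup (I : Type) (P : set I) (U : I -> set X) :
  finite_set P -> (forall i, P i -> gopen (U i)) -> gopen (\bigcup_(i in P) U i).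
Proof.
move=> fP oU; have [|+ _ _] := gts_finiteness (finite_image U fP).
  by move=> _ [i Pi <-]; exact: oU.
by rewrite bigcup_image.
Qed.

Lemma gopen_bigcap (I : Type) (P : set I) (U : I -> set X) :
  finite_set P -> (forall i, P i -> gopen (U i)) -> gopen (\bigcap_(i in P) U i).
Proof.
move=> fP oU; have [|_ + _] := gts_finiteness (finite_image U fP).
  by move=> _ [i Pi <-]; exact: oU.
by rewrite bigcap_image.
Qed.

Lemma gopenT : gopen [set: X].
Proof.
by have [|_ + _] := @gts_finiteness X set0 (finite_set0 _); rewrite ?bigcap_set0.
Qed.

Lemma gopenI U V : gopen U -> gopen V -> gopen (U `&` V).
Proof.
move=> oU oV; have -> : U `&` V = \bigcap_(b in [set: bool]) (if b then U else V).
  apply/seteqP; split=> [x [Ux Vx] [] //|x H].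
  by split; [exact: (H true I) | exact: (H false I)].
by apply: gopen_bigcap => [|[]]//; exact: finite_finset.
Qed.

End GtsFacts.

Lemma gopen_preimage (X Y : gts) (f : X -> Y) (V : set Y) :
  strictly_continuous f -> gopen V -> gopen (f @^-1` V).
Proof.
move=> cf oV; have [|_ _ cV] := @gts_finiteness Y [set V] (finite_set1 V).
  by move=> _ ->.
by apply: (gcov_gopen (cf _ cV)); exists V.
Qed.

Lemma essentially_finite_image (S T : Type) (h : set S -> set T) (F : set (set S)) :
  (forall G : set (set S), h (\bigcup_(A in G) A) = \bigcup_(A in G) h A) ->
  essentially_finite F -> essentially_finite (h @` F).
Proof.
move=> hU [G [fG GF UG]]; exists (h @` G).
split; [exact: finite_image | exact: image_subset |].
by rewrite !bigcup_image -!hU UG.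
Qed.

(** Any family of sets closed under finite unions and finite intersections is
    the family of open sets of a generalized topology whose admissible families
    are the essentially finite ones. *)
Section EssentiallyFiniteGts.
Variables (T : Type) (o : set (set T)).
Hypothesis oU : forall F : set (set T),
  finite_set F -> F `<=` o -> o (\bigcup_(A in F) A).
Hypothesis oI : forall F : set (set T),
  finite_set F -> F `<=` o -> o (\bigcap_(A in F) A).

Definition essfin_cov : set (set (set T)) :=
  [set F | F `<=` o /\ essentially_finite F].

Lemma essfin_cov_open F : essfin_cov F -> F `<=` o.
Proof. by case. Qed.

Lemma essfin_finiteness F : finite_set F -> F `<=` o ->
  [/\ o (\bigcup_(A in F) A), o (\bigcap_(A in F) A) & essfin_cov F].
Proof. by move=> fF oF; split; [exact: oU|exact: oI|split=> //; exists F; split]. Qed.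

Lemma essfin_stability V F : o V -> essfin_cov F -> essfin_cov [set V `&` A | A in F].
Proof.
move=> oV [oF eF]; split=> [_ [A FA <-]|].
  have := @oI [set V; A]; rewrite bigcap_setU1 bigcap_set1; apply.
    by rewrite finite_setU; split; exact: finite_set1.
  by move=> _ [->|->] //; exact: oF.
by apply: essentially_finite_image eF => G; exact: setI_bigcupr.
Qed.

Lemma essfin_transitivity (Phi : set (set (set T))) :
    Phi `<=` essfin_cov -> essfin_cov [set \bigcup_(A in F) A | F in Phi] ->
  essfin_cov (\bigcup_(F in Phi) F).
Proof.
move=> cPhi [_ [G [fG GPhi UG]]]; split.
  by move=> A [F /cPhi[+ _] FA]; exact.
have /choice[h hP] : forall B, exists H : set (set T), G B ->
    [/\ finite_set H, H `<=` \bigcup_(F in Phi) F & \bigcup_(A in H) A = B].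
  move=> B; have [/GPhi[F PF <-]|] := pselect (G B); last by exists set0.
  have [_ [H [fH HF UH]]] := cPhi _ PF.
  by exists H => _; split=> // A /HF FA; exists F.
exists (\bigcup_(B in G) h B); split.
- by apply: bigcup_finite => // B /hP[].
- by move=> A [B /hP[_ + _] hBA]; exact.
- rewrite !bigcup_bigcup -(bigcup_image Phi (fun F => \bigcup_(A in F) A) id) -UG.
  by apply: eq_bigcupr => B /hP[].
Qed.

Lemma essfin_saturation F G :
  essfin_cov F -> G `<=` o -> refines F G -> essfin_cov G.
Proof.
move=> [_ [H [fH HF UH]]] oG [FG rFG]; split=> //.
have /choice[b bP] : forall A, exists B, H A -> G B /\ A `<=` B.
  move=> A; have [/HF/rFG[B GB AB]|] := pselect (H A); first by exists B.
  by exists set0.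
exists (b @` H); split; first exact: finite_image.
  by move=> _ [A /bP[+ _] <-].
rewrite bigcup_image; apply/seteqP; split=> x.
  by move=> [A /bP[GbA _] bAx]; exists (b A).
by rewrite -FG -UH => -[A HA Ax]; exists A => //; have [_] := bP A HA; exact.
Qed.

Lemma essfin_regularity W F :
    essfin_cov F -> [set W `&` A | A in F] `<=` o ->
  o (W `&` \bigcup_(A in F) A).
Proof.
move=> [_ [G [fG GF <-]]] WF; rewrite setI_bigcupr -(bigcup_image G (setI W) id).
apply: oU; first exact: finite_image.
by apply: subset_trans WF; exact: image_subset.
Qed.

Definition essfin_gts : gts :=
  Gts essfin_cov_open essfin_finiteness essfin_stability essfin_transitivity
      essfin_saturation essfin_regularity.

End EssentiallyFiniteGts.

(** * The space determined by a family of plots *)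

Section PlotSpace.
Variables (M : wt_structure) (T : Type).
Variable plot : forall n (D : set (pow M n)), definable D -> (D -> T) -> Prop.

Definition plot_open : set (set T) :=
  [set A | forall n (D : set (pow M n)) (dD : definable D) p, plot dD p ->
     gopen (p @^-1` A : set (definable_set_space dD))].

Lemma plot_open_bigcup F : finite_set F -> F `<=` plot_open ->
  plot_open (\bigcup_(A in F) A).
Proof.
move=> fF oF n D dD p Pp; rewrite preimage_bigcup.
by apply: gopen_bigcup => // A /oF; exact.
Qed.

Lemma plot_open_bigcap F : finite_set F -> F `<=` plot_open ->
  plot_open (\bigcap_(A in F) A).
Proof.
move=> fF oF n D dD p Pp; rewrite preimage_bigcap.
by apply: gopen_bigcap => // A /oF; exact.
Qed.

Definition plot_gts : gts := essfin_gts plot_open_bigcup plot_open_bigcap.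

Definition plot_sections (U : set plot_gts) : set (U -> M) :=
  [set h | forall n (D : set (pow M n)) (dD : definable D) p, plot dD p ->
     psec (definable_set_space dD) (p @^-1` U)
       (fun z Uz => h (SigSub (mem_set (Uz : U (p z)))))].

Lemma plot_restriction (U V : set plot_gts) : gopen U -> gopen V ->
  forall (VU : V `<=` U) (s : U -> M),
  plot_sections s -> plot_sections (s \o subfun VU).
Proof.
move=> oU oV VU s Ss n D dD p Pp.
have sub : p @^-1` V `<=` p @^-1` U by move=> z /VU.
have := @psec_restrict _ (definable_set_space dD) _ _ sub _
  (oU _ _ _ _ Pp) (oV _ _ _ _ Pp) (Ss _ _ _ _ Pp).
apply: psec_ext => //.
by move=> z Uz Vz; congr s; exact: val_inj.
Qed.

Lemma plot_gluing (F : set (set plot_gts)) : gcov F ->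
  forall s : (forall A : F, val A -> M),
  (forall A : F, plot_sections (s A)) ->
  (forall A B : F, s A \o subfun (@subIsetl _ (val A) (val B)) =
                   s B \o subfun (@subIsetr _ (val A) (val B))) ->
  exists! t : (\bigcup_(A in F) A) -> M,
    plot_sections t /\
    forall A : F, t \o subfun (bigcup_sup (set_valP A)) = s A.
Proof.
move=> cF; apply: local_gluing => t St n D dD p Pp.
pose F' : set (set (definable_set_space dD)) := [set p @^-1` A | A in F].
have UF' : \bigcup_(A in F') A = p @^-1` \bigcup_(A in F) A.
  by rewrite preimage_bigcup bigcup_image.
have cF' : gcov F'.
  have [oF eF] := cF; apply: gcov_essentially_finite.
    by move=> _ [A /oF oA <-]; exact: oA.
  by apply: essentially_finite_image eF => G; rewrite preimage_bigcup.
pose g z (Uz : (\bigcup_(A in F') A) z) : M :=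
  t (SigSub (mem_set (@subsetW _ _ _ UF' z Uz : (\bigcup_(A in F) A) (p z)))).
suff : psec (definable_set_space dD) _ g.
  by apply: psec_ext => // z Uz Vz; congr t; exact: val_inj.
apply: psec_glue => // A' FA'; have [A FA AA'] := FA'.
apply: psec_ext (St (SigSub (mem_set FA)) n D dD p Pp) => // z Uz Vz.
by congr t; exact: val_inj.
Qed.

Definition plot_space : space M :=
  Space (FunctionSheaf plot_restriction plot_gluing).

Lemma psec_plot (U : set plot_space) (g : forall x, U x -> M) :
  psec plot_space U g <-> forall n (D : set (pow M n)) (dD : definable D) p,
    plot dD p -> psec (definable_set_space dD) (p @^-1` U) (fun z => g (p z)).
Proof.
by split=> H n D dD p /H; apply: psec_ext => // z Uz Vz;
  congr (g (p z) _); exact: Prop_irrelevance.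
Qed.

End PlotSpace.

(** * Open embeddings *)

Definition finitary (X : gts) : Prop :=
  forall F : set (set X), gcov F -> essentially_finite F.

Lemma definable_finitary (M : wt_structure) n (D : set (pow M n)) (dD : definable D) :
  finitary (definable_set_space dD).
Proof. by move=> F []. Qed.

Lemma plot_finitary (M : wt_structure) T plot : finitary (@plot_space M T plot).
Proof. by move=> F []. Qed.

(** When admissibility in the target means essential finiteness, strict
    continuity is automatic for maps pulling open sets back to open sets. *)
Lemma finitary_morphism (M : Type) (X Y : space M) (f : X -> Y) : finitary Y ->
  (forall V, gopen V -> gopen (f @^-1` V)) ->
  (forall V (g : forall y, V y -> M), gopen V -> psec Y V g ->
     psec X (f @^-1` V) (fun x => g (f x))) ->
  exists m : morphism X Y, mor_fun m = f.
Proof.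
move=> fY fo fs; have cf : strictly_continuous f.
  move=> F cF; apply: gcov_essentially_finite.
    by move=> _ [V FV <-]; apply: fo; exact: gcov_gopen FV.
  by apply: essentially_finite_image (fY _ cF) => G; rewrite preimage_bigcup.
suff fh V : gopen V -> forall h : V -> M, space_sheaf Y V h ->
    space_sheaf X (f @^-1` V) (h \o @preimage_map _ _ f V) by exists (Morphism cf fh).
by move=> oV h /psecE/(fs _ _ oV).
Qed.

Lemma gopen_morphism (M : Type) (X Y : space M) (f : morphism X Y) (V : set Y) :
  gopen V -> gopen (f @^-1` V).
Proof. exact: gopen_preimage (@mor_strictly_continuous _ _ _ f). Qed.

Definition open_embedding (M : Type) (Y X : space M) (q : morphism Y X) : Prop :=
  [/\ injective q, forall B, gopen B -> gopen (q @` B) &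
      forall A (g : forall x, A x -> M), gopen A -> A `<=` range q ->
        psec Y (q @^-1` A) (fun y => g (q y)) -> psec X A g].

Section OpenEmbeddings.
Variable M : Type.
Implicit Types X Y Z : space M.

Lemma open_embedding_comp X Y Z (q : morphism Y X) (r : morphism Z Y) :
  open_embedding q -> open_embedding r -> open_embedding (comp_morphism q r).
Proof.
move=> [qi qo qs] [ri ro rs]; split=> [|B oB|A g oA Aqr sA].
- by move=> x y /qi/ri.
- by rewrite -[_ @` _](image_comp r q); exact/qo/ro.
- have Aq : A `<=` range q by move=> x /Aqr[z _ <-]; exists (r z).
  apply: qs => //; apply: rs sA; first exact: gopen_morphism.
  by move=> y /Aqr[z _ /qi <-]; exists z.
Qed.

Lemma open_embedding_iso X Y (f : morphism X Y) (g : morphism Y X) :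
  comp_morphism g f = id_morphism X -> comp_morphism f g = id_morphism Y ->
  open_embedding f.
Proof.
move=> gf1 fg1.
have gf : cancel f g.
  exact: (fun x => congr1 (fun m : morphism X X => mor_fun m x) gf1).
have fg : cancel g f.
  exact: (fun y => congr1 (fun m : morphism Y Y => mor_fun m y) fg1).
split=> [|B oB|A s oA _ sA]; first exact: can_inj gf.
- suff -> : f @` B = g @^-1` B by exact: gopen_morphism.
  by apply/seteqP; split=> [_ [x Bx <-]|y By] /=; [rewrite gf | exists (g y)].
- have oA' := gopen_morphism f oA.
  have := psec_pull g oA' sA; apply: psec_ext => [|y H1 H2].
    by apply/seteqP; split=> y /=; rewrite fg.
  by move: H1 => /=; rewrite fg => H1; congr (s y); exact: Prop_irrelevance.
Qed.

(** The inverse bijection is strictly continuous because [Y] is finitary. *)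
Lemma surjective_open_embedding X Y (q : morphism Y X) : finitary Y ->
  open_embedding q -> range q = setT -> isomorphic (X : SpaceCat M) (Y : SpaceCat M).
Proof.
move=> fY [qi qo qs] qT.
have /choice[r qr] : forall x, exists y, q y = x.
  by move=> x; have [y _ <-] : range q x by [rewrite qT]; exists y.
have rq y : r (q y) = y by exact: qi.
have rB B : r @^-1` B = q @` B.
  by apply/seteqP; split=> [x Bx|_ [y By <-]] /=; [exists (r x) | rewrite rq].
have [V oV|V g oV sV|m mr] := @finitary_morphism M X Y r fY.
- by rewrite rB; exact: qo.
- apply: qs => //; [by rewrite rB; exact: qo | by rewrite qT |].
  apply: psec_ext sV => [|y Vy]; last move=> /=.
    by apply/seteqP; split=> y /=; rewrite rq.
  by rewrite rq => H; congr (g y); exact: Prop_irrelevance.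
by exists m, q; split; apply: morphism_eq; apply/funext => x /=; rewrite mr.
Qed.

End OpenEmbeddings.

(** * Open subspaces and charts *)

Section OpenSubspaceEmbedding.
Variables (M : Type) (X : space M) (U : set X) (oU : gopen U).
Local Notation XU := (open_subspace oU).

(** Transport of a function along the identification of [A] with its image.  It
    is stated as an existence because [M] may be empty and offers no default
    value. *)
Lemma image_section (A : set U) (g : forall u, A u -> M) :
  exists h : forall x, (val @` A) x -> M,
    forall u (Au : A u) Ah, h (val u) Ah = g u Au.
Proof.
exists (fun x Ax => g _ (s2valP (cid2 Ax))) => u Au Ah.
case: (cid2 Ah) => u' Au' E /=; have uu' := val_inj E; subst u'.
exact: (congr1 (g u) (Prop_irrelevance _ _)).
Qed.

Lemma psec_sub (A : set U) (g : forall u, A u -> M)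
    (h : forall x, (val @` A) x -> M) :
  (forall u (Au : A u) Ah, h (val u) Ah = g u Au) ->
  psec XU A g <-> psec X (val @` A) h.
Proof.
move=> hg; have hgE (u : A) Ah : h (val (val u)) Ah = g (val u) (set_valP u).
  exact: hg.
split=> [[k sk kE]|sh]; last first.
  exists (fun x => h (val x) (set_valP x)) => //.
  by apply/funext => u; rewrite /= -(hgE u (set_valP (image_map val u))).
move: sk; congr (sections _ _ _); apply/funext => x.
have [u Au ux] := set_valP x; pose u' : A := SigSub (mem_set Au).
have -> : x = image_map val u' by exact: val_inj.
by rewrite hgE; exact: (congr1 (fun s => s u') (esym kE)).
Qed.

Lemma open_subspace_embedding : exists q : morphism XU X,
  mor_fun q = val /\ open_embedding q.
Proof.
have vI (A : set X) : val @` (val @^-1` A : set U) = U `&` A.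
  apply/seteqP; split=> [_ [u Au <-]|x [Ux Ax]]; first by split=> //; exact: set_valP.
  by exists (SigSub (mem_set Ux)).
have sc : strictly_continuous (val : XU -> X).
  move=> F cF; have := gts_stability oU cF; rewrite /gcov /= /sub_gcov /=; congr gcov.
  apply/seteqP; split=> [_ [A FA <-]|_ [_ [A FA <-] <-]].
    by exists (val @^-1` A); [exists A | exact: vI].
  by exists A => //; rewrite vI.
have sv V : gopen V -> forall h : V -> M, space_sheaf X V h ->
    space_sheaf XU (val @^-1` V) (h \o @preimage_map XU _ val V).
  move=> oV h /psecE sh; have sub : val @` (val @^-1` V : set U) `<=` V.
    by move=> _ [u Vu <-].
  have oV' : gopen (val @` (val @^-1` V : set U)) by rewrite vI; exact: gopenI.
  apply/psecE; apply/(psec_sub _).2; last exact: (psec_restrict sub oV oV' sh).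
  by move=> u Vu Ah /=; congr h; exact: val_inj.
exists (Morphism sc sv); split=> //.
split=> [|B oB|A g oA AU sg]; [exact: val_inj | exact: oB |].
have AE : val @` (val @^-1` A : set U) = A.
  by rewrite vI setIidr // => x /AU[u _ <-]; exact: set_valP.
have sub : val @` (val @^-1` A : set U) `<=` A by rewrite AE.
have := sg; move/(psec_sub (h := fun x Hx => g x (sub x Hx))) => H.
apply: psec_ext (H _) => // [x Ux Vx|u Au Ah]; congr g; exact: Prop_irrelevance.
Qed.

Lemma open_subspace_iso (Y : space M) (q : morphism Y X) : finitary Y ->
  open_embedding q -> range q = U -> isomorphic (XU : SpaceCat M) (Y : SpaceCat M).
Proof.
move=> fY [qi qo qs] qU.
have Uq y : U (q y) by rewrite -qU; exists y.
pose q' (y : Y) : XU := SigSub (mem_set (Uq y)).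
have q'E (A : set U) : q @^-1` (val @` A) = q' @^-1` A.
  apply/seteqP; split=> [y [u Au uq]|y Ay]; last by exists (q' y).
  by rewrite /preimage /=; have -> : q' y = u by exact: val_inj.
have q'I (B : set Y) : val @` (q' @` B) = q @` B by rewrite image_comp.
have sc : strictly_continuous q'.
  move=> F cF; have := @mor_strictly_continuous _ _ _ q _ cF; congr gcov.
  by rewrite image_comp; apply: eq_imagel => A _ /=; rewrite q'E.
have sq V : gopen V -> forall h : V -> M, space_sheaf XU V h ->
    space_sheaf Y (q' @^-1` V) (h \o @preimage_map _ _ q' V).
  move=> oV h /psecE sh.
  have [k kE] := image_section (fun u (Vu : V u) => h (SigSub (mem_set Vu))).
  have := psec_pull q oV ((psec_sub kE).1 sh).
  move=> H; apply/psecE; apply: psec_ext H => [|y H1 H2]; first exact: q'E.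
  by rewrite (kE (q' y) H2) /=; congr h; exact: val_inj.
apply: (@surjective_open_embedding M XU Y (Morphism sc sq)) => //; last first.
  apply/seteqP; split=> // u _; have : range q (val u) by rewrite qU; exact: set_valP.
  by move=> [y _ qy]; exists y => //; exact: val_inj.
split=> [x y /(congr1 val)/qi//|B oB|A g oA _ sg].
  by rewrite /gopen /= /sub_gopen /= q'I; exact: qo.
have [k kE] := image_section g; apply/(psec_sub kE); apply: qs => //.
  by rewrite qU => _ [u _ <-]; exact: set_valP.
apply: psec_ext sg => [|y H1 H2]; first by rewrite q'E.
by rewrite (kE (q' y) H1).
Qed.

End OpenSubspaceEmbedding.

Definition chart (M : wt_structure) (X : space M) (U : set X) : Prop :=
  exists n (D : set (pow M n)) (dD : definable D)
    (q : morphism (definable_set_space dD) X), open_embedding q /\ range q = U.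

Section Charts.
Variables (M : wt_structure) (X : space M).

Lemma iso_chart n (D : set (pow M n)) (dD : definable D) (Y : space M)
    (q : morphism Y X) :
  isomorphic (Y : SpaceCat M) (definable_set_space dD : SpaceCat M) ->
  open_embedding q -> chart (range q).
Proof.
move=> [f [g [gf fg]]] oq; exists n, D, dD, (comp_morphism q g); split.
  by apply: open_embedding_comp => //; exact: open_embedding_iso fg gf.
apply/seteqP; split=> [_ [d _ <-]|_ [y _ <-]]; first by exists (g d).
exists (f y) => //.
exact: (congr1 (fun m : morphism Y Y => q (mor_fun m y)) gf).
Qed.

Lemma affine_chart : affine_definable (X : SpaceCat M) <-> chart [set: X].
Proof.
split=> [[n [D [dD iX]]]|[n [D [dD [q [oq qT]]]]]]; last first.
  exists n, D, dD; apply: surjective_open_embedding oq qT.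
  exact: definable_finitary.
have idid : comp_morphism (id_morphism X) (id_morphism X) = id_morphism X.
  exact: morphism_eq.
have := iso_chart iX (open_embedding_iso idid idid); congr chart.
by apply/seteqP; split=> // x _; exists x.
Qed.

Lemma affine_subspace_chart (U : set X) (oU : gopen U) :
  affine_definable (open_subspace oU : SpaceCat M) <-> chart U.
Proof.
split=> [[n [D [dD iX]]]|[n [D [dD [q [oq qU]]]]]]; last first.
  by exists n, D, dD; apply: open_subspace_iso oq qU; exact: definable_finitary.
have [q [qv oq]] := open_subspace_embedding oU.
have := iso_chart iX oq; congr chart; rewrite qv.
apply/seteqP; split=> [_ [u _ <-]|x Ux]; first exact: set_valP.
by exists (SigSub (mem_set Ux)).
Qed.

(** Charts replace the affine open subspaces, which live on subtypes of [X]. *)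
Lemma definable_space_charts : definable_space (X : SpaceCat M) <->
  exists C : set (set X), [/\ finite_set C, \bigcup_(U in C) U = setT &
                              forall U, C U -> chart U].
Proof.
split=> [[C [fC oC CT aC]]|[C [fC CT cC]]]; exists C; split=> //.
- by move=> U CU; apply/(affine_subspace_chart (oC U CU)); exact: aC.
- move=> U /cC[n [D [dD [q [[_ qo _] <-]]]]].
  by apply: qo; exact: (gopenT (definable_set_space dD)).
- by move=> U oU CU; apply/affine_subspace_chart; exact: cC.
Qed.

Lemma affine_definable_space :
  affine_definable (X : SpaceCat M) -> definable_space (X : SpaceCat M).
Proof.
move=> /affine_chart cX; apply/definable_space_charts; exists [set setT].
by split; [exact: finite_set1 | rewrite bigcup_set1 | move=> _ ->].
Qed.

(** A chart is strictly continuous, so it pulls an admissible family back to an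
    essentially finite one; finitely many charts cover the space. *)
Lemma definable_space_finitary : definable_space (X : SpaceCat M) -> finitary X.
Proof.
move=> /definable_space_charts[C [fC CT cC]] F cF.
have /choice[G GP] : forall U, exists G : set (set X), C U ->
    [/\ finite_set G, G `<=` F & U `&` \bigcup_(A in F) A `<=` \bigcup_(A in G) A].
  move=> U; have [CU|] := pselect (C U); last by exists set0.
  have [n [D [dD [q [_ qU]]]]] := cC U CU.
  have [_ [H [fH HF UH]]] := @mor_strictly_continuous _ _ _ q _ cF.
  have /choice[b bP] : forall B, exists A, H B -> F A /\ B = q @^-1` A.
    move=> B; have [/HF[A FA <-]|] := pselect (H B); first by exists A.
    by exists set0.
  exists (b @` H) => _; split; first exact: finite_image.
    by move=> _ [B /bP[FbB _] <-].
  rewrite -qU => x [[d _ <-] Fx].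
  have : (\bigcup_(B in [set q @^-1` A | A in F]) B) d.
    by case: Fx => A FA Ax; exists (q @^-1` A) => //; exists A.
  rewrite -UH bigcup_image => -[B HB Bd]; exists B => //.
  by have [_ BE] := bP B HB; move: Bd; rewrite {1}BE.
exists (\bigcup_(U in C) G U); split.
- by apply: bigcup_finite => // U /GP[].
- by move=> A [U /GP[_ + _]]; exact.
- apply/seteqP; split=> [x [A [U /GP[_ GF _] /GF FA] Ax]|x Fx]; first by exists A.
  have : (\bigcup_(U in C) U) x by rewrite CT.
  move=> [U CU Ux]; have [_ _ /(_ x (conj Ux Fx))[A GA Ax]] := GP U CU.
  by exists A => //; exists U.
Qed.

End Charts.

Lemma psec_bigcup (M : Type) (X : space M) (I : Type) (P : set I) (U : I -> set X)
    (g : forall x, (\bigcup_(i in P) U i) x -> M) :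
  finite_set P -> (forall i, P i -> gopen (U i)) ->
  (forall i (Pi : P i), psec X (U i) (fun x Ux => g x (bigcup_sup Pi Ux))) ->
  psec X (\bigcup_(i in P) U i) g.
Proof.
move=> fP oU sg; have UE : \bigcup_(A in [set U i | i in P]) A = \bigcup_(i in P) U i.
  exact: bigcup_image.
have [|_ _ cF] := gts_finiteness (finite_image U fP).
  by move=> _ [i Pi <-]; exact: oU.
have H : psec X _ (fun x Ux => g x (@subsetW _ _ _ UE x Ux)).
  apply: psec_glue => // A FA; have [i Pi iA] := FA.
  apply: psec_ext (sg i Pi) => // x Ux Ax.
  exact: (congr1 (g x) (Prop_irrelevance _ _)).
by apply: psec_ext H => // x Ux Vx; exact: (congr1 (g x) (Prop_irrelevance _ _)).
Qed.

(** * Coordinate functions *)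

Section DefinableCoordinates.
Variables (M : wt_structure) (n : nat) (D : set (pow M n)) (dD : definable D).
Local Notation X := (definable_set_space dD).

Lemma definable_eq N (i j : 'I_N) : definable [set v : pow M N | v i = v j].
Proof. by exists (Equal (Var M i) (Var M j)). Qed.

Lemma psec_coordinate k : psec X setT (fun d _ => val d k).
Proof.
split; last first.
  move=> x; apply: (@continuous_comp _ _ _ (fun y : [set: D] => val (val y))
                                     (fun v : pow M n => v k)).
    apply: continuous_comp; exact: initial_continuous.
  exact: (@proj_continuous _ (fun _ : 'I_n => M : topologicalType) k).
have := definableI (definable_rename (fun j : 'I_n => lift ord_max j) dD)
                   (definable_eq (lift ord_max k) ord_max).
congr definable.
apply/seteqP; split=> v; last first.
  move=> [x _ <-]; split=> /=; last by rewrite snoc_lift snoc_max.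
  have -> : snoc (val (val x)) (val (val x) k) \o (fun j => lift ord_max j) =
      val (val x).
    by apply/funext => j /=; rewrite snoc_lift.
  exact: set_valP.
move=> [/= Dv vk]; pose d : D := SigSub (mem_set Dv).
exists (SigSub (mem_set (I : setT d))) => //=.
apply/funext => i; case: (unliftP ord_max i) => [j ->|->].
  by rewrite snoc_lift.
by rewrite snoc_max.
Qed.

Lemma definable_morphism m (E : set (pow M m)) (dE : definable E) (f : D -> E) :
  (forall k, psec X setT (fun d _ => val (f d) k)) ->
  exists h : morphism X (definable_set_space dE), mor_fun h = f.
Proof.
move=> fs; have oT := gopenT X.
have TE (V : set E) : [set x : D | exists Ax : setT x, V (f x)] = f @^-1` V.
  by apply/seteqP; split=> [x []|x Vx]//; exists I.
apply: finitary_morphism; first exact: definable_finitary.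
  move=> V oV; have := @gopen_pull _ _ _ dD _ _ dE setT (fun x _ => f x) oT fs V oV.
  by rewrite TE.
move=> V g oV sg.
pose h (x : D) (H : exists Ax : setT x, V (f x)) :=
  g (f x) (let: ex_intro _ Vx := H in Vx).
have := @psec_dpull _ _ _ dD _ _ dE setT (fun x _ => f x) oT fs V g h oV sg.
move=> H; apply: psec_ext (H _) => //.
  by move=> x H1 H2; rewrite /h; exact: (congr1 (g (f x)) (Prop_irrelevance _ _)).
by move=> x H1 Ax Bx; rewrite /h; exact: (congr1 (g (f x)) (Prop_irrelevance _ _)).
Qed.

(** The coordinates of a chart are sections on its range.  This is how the
    definable sets behind the charts are reached from inside the space. *)
Lemma embedding_inverse (Y : space M) (q : morphism X Y) : open_embedding q ->
  exists c : forall y, range q y -> D, (forall y Ry, q (c y Ry) = y) /\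
    forall k, psec Y (range q) (fun y Ry => val (c y Ry) k).
Proof.
move=> [qi qo qs]; pose c y (Ry : range q y) : D := s2val (cid2 Ry).
have cK y Ry : q (c y Ry) = y by exact: (s2valP' (cid2 Ry)).
exists c; split=> // k; apply: qs => //; first exact: qo (gopenT X).
apply: psec_ext (psec_coordinate k); first by apply/seteqP; split=> // x _; exists x.
by move=> x _ Rx; have -> : c (q x) Rx = x by exact: qi.
Qed.

End DefinableCoordinates.

Lemma plot_morphism (M : wt_structure) T plot n (D : set (pow M n)) (dD : definable D)
    (p : D -> T) : plot n D dD p ->
  exists h : morphism (definable_set_space dD) (plot_space plot), mor_fun h = p.
Proof.
move=> Pp; apply: finitary_morphism; first exact: plot_finitary.
  by move=> V; exact.
by move=> V g oV /psec_plot; exact.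
Qed.

(** * The limit of a finite diagram *)

Section Limit.
Variables (M : wt_structure) (J : finite_category) (X : fin_obj J -> space M).
Variable m : forall i j : fin_obj J, fin_hom i j -> morphism (X i) (X j).

Definition limit_point :=
  {x : forall j, X j | forall i j (f : fin_hom i j), m f (x i) = x j}.

Definition LimitPoint (x : forall j, X j)
    (xE : forall i j (f : fin_hom i j), m f (x i) = x j) : limit_point :=
  exist _ x xE.

Lemma limit_point_eq (x y : limit_point) : (forall j, sval x j = sval y j) -> x = y.
Proof.
case: x y => [x xE] [y yE] xy; have {}xy : x = y := functional_extensionality_dep xy.
by subst y; rewrite (Prop_irrelevance xE yE).
Qed.

Definition limit_plot n (D : set (pow M n)) (dD : definable D)
    (p : D -> limit_point) : Prop :=
  forall j, exists h : morphism (definable_set_space dD) (X j),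
    forall d, h d = sval (p d) j.

Definition limit_space : space M := plot_space limit_plot.

Lemma limit_leg j : finitary (X j) ->
  exists h : morphism limit_space (X j), forall x, h x = sval x j.
Proof.
move=> fX; pose f (x : limit_space) := sval x j.
suff [h hE] : exists h : morphism limit_space (X j), mor_fun h = f.
  by exists h => x; rewrite hE.
apply: finitary_morphism => // [V oV n D dD p Pp|V g oV sg].
  have [h hE] := Pp j; have := gopen_morphism h oV.
  by congr gopen; apply/seteqP; split=> d; rewrite /preimage /= hE.
apply/psec_plot => n D dD p Pp.
have [h hE] := Pp j; have := psec_pull h oV sg; apply: psec_ext.
  by apply/seteqP; split=> d; rewrite /preimage /= hE.
move=> d; rewrite /f /preimage /= hE => H1 H2.
exact: (congr1 (g _) (Prop_irrelevance _ _)).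
Qed.

(** The charts of [K] become plots of the limit, and openness and sections on [K]
    are tested on a finite cover by charts. *)
Lemma limit_mediating (K : space M) (k : forall j, morphism K (X j)) :
  definable_space (K : SpaceCat M) ->
  (forall i j (f : fin_hom i j) x, m f (k i x) = k j x) ->
  exists u : morphism K limit_space, forall x j, sval (u x) j = k j x.
Proof.
move=> /definable_space_charts[C [fC CT cC]] kE.
pose u x : limit_space := LimitPoint (fun i j f => kE i j f x).
suff [h hE] : exists h : morphism K limit_space, mor_fun h = u.
  by exists h => x j; rewrite hE.
have uP n (D : set (pow M n)) (dD : definable D)
    (q : morphism (definable_set_space dD) K) :
    limit_plot dD (u \o q).
  by move=> j; exists (comp_morphism (k j) q).
have UE V : u @^-1` V = \bigcup_(U in C) (U `&` u @^-1` V).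
  by rewrite -setI_bigcupl CT setTI.
have oU V U : gopen V -> C U -> gopen (U `&` u @^-1` V).
  move=> oV /cC[n [D [dD [q [[_ qo _] <-]]]]].
  have := qo _ (oV _ _ _ _ (uP _ _ _ q)); congr gopen.
  apply/seteqP; split=> [_ [d Vd <-]|_ [[d _ <-] Vd]]; last by exists d.
  by split=> //; exists d.
apply: finitary_morphism; first exact: plot_finitary.
  by move=> V oV; rewrite UE; apply: gopen_bigcup => // U; exact: oU.
move=> V g oV /psec_plot sg.
have sub : \bigcup_(U in C) (U `&` u @^-1` V) `<=` u @^-1` V by rewrite -UE.
suff : psec K (\bigcup_(U in C) (U `&` u @^-1` V)) (fun x Ux => g (u x) (sub x Ux)).
  by apply: psec_ext => // x H1 H2; exact: (congr1 (g _) (Prop_irrelevance _ _)).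
apply: psec_bigcup => // [U|U CU]; first exact: oU.
have oUV := oU V U oV CU; have [n [D [dD [q [[_ qo qs] qU]]]]] := cC U CU.
apply: qs => //; first by rewrite qU; exact: subIsetl.
apply: psec_ext (sg _ _ _ _ (uP _ _ _ q)).
  apply/seteqP; split=> d; last by case.
  by split=> //; rewrite -qU; exists d.
by move=> d H1 H2; exact: (congr1 (g _) (Prop_irrelevance _ _)).
Qed.

Section LimitChart.
Variables (n : fin_obj J -> nat) (D : forall j, set (pow M (n j))).
Arguments D j : clear implicits.
Variable dD : forall j, definable (D j).
Variable q : forall j, morphism (definable_set_space (dD j)) (X j).
Hypothesis qe : forall j, open_embedding (q j).

Definition coord_index := {j : fin_obj J & 'I_(n j)}.
Local Notation N := #|{: coord_index}|.

(** The coordinates of a tuple of points, one in each [M^(n j)], are laid out in a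
    single power of [M]; [block j] lists the positions of the [j]-th point. *)
Definition block j (k : 'I_(n j)) : 'I_N :=
  enum_rank (Tagged (fun j => 'I_(n j)) k : coord_index).

Definition glue (w : forall j, 'I_(n j) -> M) (i : 'I_N) : M :=
  let s := enum_val i in w (tag s) (tagged s).

Lemma glue_block w j : glue w \o @block j = w j.
Proof. by apply/funext => k; rewrite /glue /block /= enum_rankK. Qed.

Lemma blockP (P : 'I_N -> Prop) : (forall j k, P (@block j k)) -> forall i, P i.
Proof.
move=> H i; rewrite -(enum_valK i); case: (enum_val i) => j k; exact: H.
Qed.

(** A point of the [j]-th block lies in [D j] by the condition for the identity
    arrow of [j]. *)
Definition limit_set : set (pow M N) :=
  [set v : pow M N | forall i j (f : fin_hom i j), exists (a : D i) (b : D j),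
     [/\ val a = v \o @block i, val b = v \o @block j & m f (q i a) = q j b]].

(** The condition for an arrow [f] from [i] to [j] says that [m f] sends the
    [i]-th point into the range of the [j]-th chart, and that the coordinates
    there, sections on an open subset of [D i], are those of the [j]-th
    point. *)
Lemma definable_limit_set : definable limit_set.
Proof.
have -> : limit_set = \bigcap_(i in [set: fin_obj J]) \bigcap_(j in [set: fin_obj J])
    \bigcap_(f in [set: fin_hom i j]) [set v : pow M N | exists (a : D i) (b : D j),
     [/\ val a = v \o @block i, val b = v \o @block j & m f (q i a) = q j b]].
  by apply/seteqP; split=> v H i; [move=> _ j _ f _; exact: H | move=> j f; exact: H].
apply: definable_bigcap => i _; apply: definable_bigcap => j _.
apply: definable_bigcap => f _.
have [c [cK cs]] := embedding_inverse (qe j); have [qi qo _] := qe j.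
pose h := comp_morphism (m f) (q i).
have oR : gopen (range (q j)) by exact: qo (gopenT (definable_set_space (dD j))).
have oA := gopen_morphism h oR.
have fs k := psec_pull h oR (cs k).
pose S : set (pow M (N + n j)) := \bigcap_(k in [set: 'I_(n j)])
  [set v : pow M (N + n j) | v (lshift _ (@block j k)) = v (rshift _ k)].
have dS : definable S by apply: definable_bigcap => k _; exact: definable_eq.
have := definable_pull (dD := dD i) (f := fun x Ax => val (c (h x) Ax))
  oA fs (@block i) dS.
congr definable; apply/seteqP; split=> v.
  move=> [a [Ra [av Sv]]]; exists a, (c (h a) Ra); split=> //.
  by apply/funext => k; have := Sv k I; rewrite /= join_ptl join_ptr.
move=> [a [b [av bv fab]]].
have Ra : range (q j) (h a) by exists b.
exists a, Ra; split=> // k _ /=; rewrite join_ptl join_ptr.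
have -> : c (h a) Ra = b by apply: qi; rewrite cK.
by rewrite bv.
Qed.

(** Over the points whose components lie in the charts, a plot of the limit
    becomes a map into [limit_set] whose coordinates are sections, namely those
    of the charts composed with the components of the plot.  So open sets and
    sections on [limit_set] can be recognised along every plot, which is what
    openness and sections in the limit mean. *)
Lemma limit_chart_of :
  @chart M limit_space [set x : limit_point | forall j, range (q j) (sval x j)].
Proof.
set R : set limit_point := [set x | _]; pose dE := definable_limit_set.
have ED j (e : limit_set) : D j (val e \o @block j).
  by have [a [_ [<- _ _]]] := set_valP e j j (fin_idc j); exact: set_valP.
pose pr j (e : limit_set) : D j := SigSub (mem_set (ED j e)).
have Qcompat e i j (f : fin_hom i j) : m f (q i (pr i e)) = q j (pr j e).
  have [a [b [av bv fab]]] := set_valP e i j f.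
  have -> : pr i e = a by exact: val_inj.
  by have -> : pr j e = b by exact: val_inj.
pose Q e : limit_space := LimitPoint (Qcompat e).
have prm j : exists h : morphism (definable_set_space dE)
    (definable_set_space (dD j)), mor_fun h = pr j.
  by apply: definable_morphism => k; exact: psec_coordinate.
have QP : limit_plot dE Q.
  move=> j; have [h hE] := prm j.
  by exists (comp_morphism (q j) h) => e /=; rewrite hE.
have [Qm QmE] := plot_morphism QP.
pose c j := sval (cid (embedding_inverse (qe j))).
have cP j : (forall y Ry, q j (c j y Ry) = y) /\
    forall k, psec (X j) (range (q j)) (fun y Ry => val (c j y Ry) k).
  exact: (svalP (cid (embedding_inverse (qe j)))).
pose w x (Rx : R x) := glue (fun j => val (c j (sval x j) (Rx j))).
have wE x Rx j : w x Rx \o @block j = val (c j (sval x j) (Rx j)).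
  exact: glue_block.
have wP x Rx : limit_set (w x Rx).
  move=> i j f; exists (c i (sval x i) (Rx i)), (c j (sval x j) (Rx j)).
  by rewrite !wE !(cP _).1; split=> //; exact: svalP x _ _ _.
pose e x Rx : limit_set := SigSub (mem_set (wP x Rx)).
have Qe x Rx : Q (e x Rx) = x.
  apply: limit_point_eq => j /=; rewrite -[RHS](cP j).1; congr (q j _).
  by apply: val_inj; exact: wE.
have Qi : injective Q.
  move=> a b Qab; apply: val_inj; apply/funext; apply: blockP => j k.
  have /= := congr1 (fun x => sval x j) Qab; have [qi _ _] := qe j => /qi.
  by move=> /(congr1 val)/(congr1 (fun v => v k)).
have QR a : R (Q a) by move=> j; exists (pr j a).
(* In the charts, a plot [p] is a map into [limit_set] whose domain is open and
   whose coordinates are sections. *)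
have AE n0 (D0 : set (pow M n0)) (dD0 : definable D0) (p : D0 -> limit_point) :
    limit_plot dD0 p ->
    gopen (p @^-1` R : set (definable_set_space dD0)) /\
    forall k, psec (definable_set_space dD0) (p @^-1` R)
                (fun z Rz => val (e (p z) Rz) k).
  move=> Pp; have oj j : gopen
      ([set z | range (q j) (sval (p z) j)] : set (definable_set_space dD0)).
    have [_ qo _] := qe j; have [h hE] := Pp j.
    have := gopen_morphism h (qo _ (gopenT (definable_set_space (dD j)))).
    by congr gopen; apply/seteqP; split=> z; rewrite /preimage /= hE.
  have oR : gopen (p @^-1` R : set (definable_set_space dD0)).
    have -> : p @^-1` R = \bigcap_(j in [set: fin_obj J])
        [set z | range (q j) (sval (p z) j)].
      by apply/seteqP; split=> z H j => [_|]; exact: H.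
    by apply: gopen_bigcap => //; exact: finite_finset.
  split=> //; apply: blockP => j k; have [h hE] := Pp j; have [_ qo _] := qe j.
  have sub : p @^-1` R `<=` h @^-1` range (q j).
    by move=> z Rz; rewrite /preimage /= hE; exact: Rz.
  have oR' : gopen (range (q j)) by exact: qo (gopenT (definable_set_space (dD j))).
  have := @psec_restrict _ (definable_set_space dD0) _ _ sub _
    (gopen_morphism h oR') oR
    (psec_pull h oR' ((cP j).2 k)).
  apply: psec_ext => // z H1 H2.
  have := congr1 (fun v => v k) (wE (p z) H2 j) => /= ->.
  move: (sub z H1); rewrite /preimage /= hE => H3.
  by congr (val (c j _ _) k); exact: Prop_irrelevance.
exists N, limit_set, dE, Qm; split; last first.
  rewrite QmE; apply/seteqP; split=> [_ [a _ <-]//|x Rx]; by exists (e x Rx).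
split; first by rewrite QmE.
  move=> B oB n0 D0 dD0 p Pp; rewrite QmE; have [oA fs] := AE _ _ _ _ Pp.
  have := gopen_pull (dE := dE) (f := fun z Rz => e (p z) Rz) oA fs oB.
  congr gopen; apply/seteqP; split=> z.
    by move=> [Rz Bz]; exists (e (p z) Rz).
  move=> [b Bb Qb]; have Rz : R (p z) by rewrite -Qb.
  by exists Rz; have -> : e (p z) Rz = b by apply: Qi; rewrite Qe.
rewrite QmE => A g oA AQ sg; apply/psec_plot => n0 D0 dD0 p Pp.
have [oR fs] := AE _ _ _ _ Pp.
have AR : A `<=` R by move=> x /AQ[a _ <-].
have pA z (H : exists Rz : R (p z), A (Q (e (p z) Rz))) : A (p z).
  by case: H => Rz; rewrite Qe.
have oQA : gopen (Q @^-1` A : set (definable_set_space dE)) by exact: oA QP.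
have := psec_dpull (dE := dE) (f := fun z Rz => e (p z) Rz)
  (h := fun z H => g (p z) (pA z H)) oR fs oQA sg.
move=> H; apply: psec_ext (H _).
- apply/seteqP; split=> z; first exact: pA.
  by move=> Az; exists (AR _ Az); rewrite /preimage /= Qe.
- by move=> z H1 H2; exact: (congr1 (g _) (Prop_irrelevance _ _)).
- move=> z H1 Rz; rewrite /preimage /= => Bz; move: Bz; rewrite Qe => Bz.
  exact: (congr1 (g _) (Prop_irrelevance _ _)).
Qed.

End LimitChart.

Lemma limit_chart (U : forall j, set (X j)) : (forall j, chart (U j)) ->
  @chart M limit_space [set x : limit_point | forall j, U j (sval x j)].
Proof.
move=> cU.
pose n j := sval (cid (cU j)); pose c1 j := svalP (cid (cU j)).
pose D j := sval (cid (c1 j)); pose c2 j := svalP (cid (c1 j)).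
pose dD j := sval (cid (c2 j)); pose c3 j := svalP (cid (c2 j)).
pose q j := sval (cid (c3 j)).
have qP j : open_embedding (q j) /\ range (q j) = U j := svalP (cid (c3 j)).
have := limit_chart_of (fun j => (qP j).1); congr chart.
by apply/seteqP; split=> x H j; have := H j; rewrite (qP j).2.
Qed.

End Limit.

(** * Finite completeness *)

Lemma limit_definable_space (M : wt_structure) (J : finite_category)
    (X : fin_obj J -> space M)
    (m : forall i j : fin_obj J, fin_hom i j -> morphism (X i) (X j)) :
  (forall j, definable_space (X j : SpaceCat M)) ->
  definable_space (limit_space m : SpaceCat M).
Proof.
move=> dX; apply/definable_space_charts.
have sX j : exists s : seq (set (X j)),
    (forall x, exists i : 'I_(size s), nth set0 s i x) /\
    forall i : 'I_(size s), chart (nth set0 s i).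
  have /definable_space_charts[C [+ CT cC]] := dX j.
  move=> /(@finite_seqP {classic (set (X j))})[s CE]; subst C.
  exists s; split=> [x|i]; last by apply: cC => /=; exact: mem_nth.
  have : (\bigcup_(U in [set` s]) U) x by rewrite CT.
  move=> [U /= sU Ux].
  have iU : index (U : {classic (set (X j))}) s < size s by rewrite index_mem.
  by exists (Ordinal iU); rewrite /= nth_index.
pose s j := sval (cid (sX j)).
have sP j : (forall x, exists i : 'I_(size (s j)), nth set0 (s j) i x) /\
    forall i : 'I_(size (s j)), chart (nth set0 (s j) i) := svalP (cid (sX j)).
pose R (c : {dffun forall j, 'I_(size (s j))}) : set (limit_point m) :=
  [set x | forall j, nth set0 (s j) (c j) (sval x j)].
exists (range R); split.
- apply: finite_image; exact: (@finite_finset {dffun forall j, 'I_(size (s j))} setT).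
- apply/seteqP; split=> // x _.
  pose c j := sval (cid ((sP j).1 (sval x j))).
  exists (R [ffun j => c j]); first by exists [ffun j => c j].
  by move=> j; rewrite ffunE; exact: (svalP (cid ((sP j).1 (sval x j)))).
- by move=> _ [c _ <-]; exact: (limit_chart m (fun j => (sP j).2 (c j))).
Qed.

Lemma limit_affine (M : wt_structure) (J : finite_category)
    (X : fin_obj J -> space M)
    (m : forall i j : fin_obj J, fin_hom i j -> morphism (X i) (X j)) :
  (forall j, affine_definable (X j : SpaceCat M)) ->
  affine_definable (limit_space m : SpaceCat M).
Proof.
move=> aX; apply/affine_chart.
have := limit_chart m (fun j => (affine_chart (X j)).1 (aX j)).
by congr chart; apply/seteqP; split.
Qed.

(** Both categories are full subcategories whose objects are definable spaces, so
    the same universal property serves for them: what differs is only the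
    membership of the limit. *)
Lemma full_subcategory_finitely_complete (M : wt_structure) (P : SpaceCat M -> Prop) :
  (forall X, P X -> definable_space X) ->
  (forall (J : finite_category) (X : fin_obj J -> space M)
     (m : forall i j : fin_obj J, fin_hom i j -> morphism (X i) (X j)),
     (forall j, P (X j)) -> P (limit_space m)) ->
  finitely_complete (full_subcategory P).
Proof.
move=> Pds Plim J F.
pose X (j : fin_obj J) : space M := sval (F j).
pose m (i j : fin_obj J) (f : fin_hom i j) : morphism (X i) (X j) :=
  fmap F (f : hom (i : J) j).
have PX j : P (X j) := svalP (F j).
have prP j := @limit_leg M J X m j (definable_space_finitary (Pds _ (PX j))).
pose pr j := sval (cid (prP j)).
have prE j x : pr j x = sval x j := svalP (cid (prP j)) x.
pose L : full_subcategory P := exist _ (limit_space m : SpaceCat M) (Plim _ _ m PX).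
have prN (i j : J) (f : hom i j) :
    comp (fmap F f) (pr i : hom L (F i)) = (pr j : hom L (F j)).
  apply: morphism_eq; apply/funext => x /=; rewrite !prE; exact: (svalP x i j f).
exists (Cone prN) => K.
pose k (j : fin_obj J) : morphism (sval (apex K)) (X j) := leg K j.
have kE i j (f : fin_hom i j) x : m i j f (k i x) = k j x.
  exact: (congr1 (fun h : morphism _ _ => mor_fun h x)
                 (leg_natural K (f : hom (i : J) j))).
have [u uE] := limit_mediating (Pds _ (svalP (apex K))) kE.
exists u; split.
  by move=> j; apply: morphism_eq; apply/funext => x /=; rewrite prE uE.
move=> v vE; apply: morphism_eq; apply/funext => x; apply: limit_point_eq => j.
rewrite uE -prE.
exact: (congr1 (fun h : morphism _ _ => mor_fun h x) (esym (vE j))).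
Qed.

Theorem proposition6p5 (M : wt_structure) :
  finitely_complete (ADS M) /\ finitely_complete (DS M).
Proof.
split; apply: full_subcategory_finitely_complete.
- exact: affine_definable_space.
- exact: limit_affine.
- by [].
- exact: limit_definable_space.
Qed.
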